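(* For every $f\in\mathcal{L}$, $f(z)=z+\sum_{k=2}^{\infty}a_{2k-1}z^{2k-1}$, and every integer $n\ge 1$, the section $s_{2n-1}(z)=z+\sum_{k=2}^{n}a_{2k-1}z^{2k-1}$ of $f$ is convex in the disk $|z|<\sqrt{2}/3$. Moreover, the radius $\sqrt{2}/3$ cannot be replaced by a greater one: for every $r>\sqrt{2}/3$ there exist $f\in\mathcal{L}$ and $n\ge 1$ such that the section $s_{2n-1}$ of $f$ is not convex in the disk $|z|<r$.
   Context: Let $\mathbb{D}=\{z\in\mathbb{C}:|z|<1\}$. The class $\mathcal{L}$ consists of all odd analytic functions $f:\mathbb{D}\to\mathbb{C}$, normalized by $f(0)=0$, $f'(0)=1$ (so $f(z)=z+\sum_{k=2}^{\infty}a_{2k-1}z^{2k-1}$ in $\mathbb{D}$), which are locally univalent in $\mathbb{D}$ (i.e. $f'(z)\neq 0$ for all $z\in\mathbb{D}$) and satisfy $$\operatorname{Re}\left(1+\frac{zf''(z)}{f'(z)}\right)>-\frac12\quad\text{for all } z\in\mathbb{D}.$$ For $n=1$ the sum defining the section is empty, so $s_1(z)=z$. A polynomial $s$ with $s(0)=0$, $s'(0)=1$ is said to be convex in the disk $|z|<r$ if $s'(z)\ne 0$ and $\operatorname{Re}\left(1+\frac{zs''(z)}{s'(z)}\right)>0$ for all $|z|<r$. *)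

(* Defs.v *)
From Stdlib Require Import Reals.
From Coquelicot Require Import Coquelicot.

Open Scope R_scope.

(* Functions on the unit disk are total functions C -> C of which only the
   values at points with Cmod z < 1 matter. *)

Definition analytic_in_unit_disk (f : C -> C) : Prop :=
  forall z : C, Cmod z < 1 ->
    ex_derive (K := C_AbsRing) (V := C_NormedModule) f z.

(* 1 + z f''(z) / f'(z), with complex derivatives *)
Definition convexity_quotient (f : C -> C) (z : C) : C :=
  (1 + z * C_derive (C_derive f) z / C_derive f z)%C.

Record class_L (f : C -> C) : Prop := {
  L_analytic : analytic_in_unit_disk f;
  L_odd : forall z : C, Cmod z < 1 -> f (- z)%C = (- f z)%C;
  L_zero : f (RtoC 0) = RtoC 0;
  L_derive_zero : C_derive f (RtoC 0) = RtoC 1;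
  L_locally_univalent : forall z : C, Cmod z < 1 -> C_derive f z <> RtoC 0;
  L_Re : forall z : C, Cmod z < 1 -> - (1 / 2) < Re (convexity_quotient f z)
}.

(* f(z) = z + sum_{k >= 2} a_{2k-1} z^{2k-1} for |z| < 1; the summation index
   is shifted so that it starts at 0, and only the entries a 3, a 5, ... of the
   sequence a are used. *)
Definition odd_expansion (f : C -> C) (a : nat -> C) : Prop :=
  forall z : C, Cmod z < 1 ->
    is_series (K := C_AbsRing) (V := C_NormedModule)
      (fun j : nat => let k := (j + 2)%nat in
         (a (2 * k - 1)%nat * z ^ (2 * k - 1))%C)
      (f z - z)%C.

(* s_{2n-1}; sum_n_m _ 2 n is the sum over 2 <= k <= n, zero when n < 2 *)
Definition odd_section (a : nat -> C) (n : nat) (z : C) : C :=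
  (z + sum_n_m (G := C_AbelianMonoid)
         (fun k : nat => a (2 * k - 1)%nat * z ^ (2 * k - 1)) 2 n)%C.

Definition convex_in_disk (s : C -> C) (r : R) : Prop :=
  forall z : C, Cmod z < r ->
    C_derive s z <> RtoC 0 /\ 0 < Re (convexity_quotient s z).

(* Main.v *)
Require Import Defs.
From Stdlib Require Import Reals Lra Lia Psatz Wf_nat.
From Coquelicot Require Import Coquelicot.

(** Write [f'(z) = g(w)] with [w = z^2] and [g(w) = sum b_k w^k].  The condition
    on [f] says that [P = 1 + (2/3) Q], with [Q = 2 w g'/g], has positive real
    part in the unit disk, and the section [s] of [f] is convex where
    [Re (2 w S'/S) > -1], [S] being the corresponding section of [g].

    Cauchy's formula on the unit circle (after a harmless dilation of [g])
    yields the Herglotz representation of [P].  It bounds [Q] for [|w| < 2/9]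
    by [Re Q >= -6/11] and [|Q| <= 6/7], and comparing coefficients in
    [2 w g' = Q g] gives [2 k |b_k| <= 3 (|b_0| + ... + |b_(k-1)|)], so that
    [|b_k|] is at most the coefficient of [w^k] in [(1 - w)^(-3/2)].  For at
    most two terms the coefficient bound alone suffices.  For three terms or
    more, [S] is so close to [g] that [2 w S'/S] differs from [Q] by less than
    [5/11].

    Sharpness comes from [f(z) = z / sqrt (1 - z^2)], where
    [g(w) = (1 - w)^(-3/2)]: its section [z + z^3/2] has a vanishing convexity
    quotient at [z = i sqrt 2 / 3]. *)

Open Scope R_scope.

(** The hypothesis on [f] reads [Re Q > -3/2], whence the factor [2/3] in [P]; the radius enters
    only through its square [2/9]. There [Re Q >= -6/11], while the section has to stay above [-1],
    so a perturbation argument has [5/11] to spend. For the extremal function and two terms the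
    difference of the logarithmic derivatives tends to [5/11] as [w] tends to [-2/9], so crude
    estimates cannot treat that case. From three terms on the remainder starts at [w^3], and
    explicit geometric majorants fit, though narrowly: about [0.449] against [0.4545].

    The function theory rests on means over the unit circle. Functions are continuously
    differentiable on a disk of radius greater than [1], so Cauchy's formula follows by
    differentiating under the integral sign, and boundary values involve no limit. Taylor
    coefficients are means against powers of [conj zeta]; this lets coefficients of a product be
    estimated without multiplying out power series. *)

Local Notation Cder f z l :=
  (is_derive (K := C_AbsRing) (V := AbsRing_NormedModule C_AbsRing) f z l).

Local Notation ccont f x := (continuous (U := C_UniformSpace) f x).

(** * Complex derivatives *)

Lemma locally_C_Cmod (z : C) (P : C -> Prop) :
  locally (T := AbsRing_UniformSpace C_AbsRing) z P <->
  exists d : posreal, forall y : C, Cmod (y - z) < d -> P y.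
Proof. split; intros [d Hd]; exists d; intros y Hy; apply Hd; exact Hy. Qed.

Lemma Cder_eps (f : C -> C) (z l : C) :
  Cder f z l <->
  forall eps : posreal, exists d : posreal, forall y : C, Cmod (y - z) < d ->
    Cmod (f y - f z - (y - z) * l) <= eps * Cmod (y - z).
Proof.
  split.
  - intros [_ H] eps. specialize (H z (fun P HP => HP) eps).
    apply locally_C_Cmod in H. exact H.
  - intros H. split.
    + exact (is_linear_scal_l (K := C_AbsRing)
               (V := AbsRing_NormedModule C_AbsRing) l).
    + intros x Hx.
      assert (Ex : z = x).
      { apply (@is_filter_lim_locally_unique C_AbsRing
                 (AbsRing_NormedModule C_AbsRing)). exact Hx. }
      subst x. intros eps.
      apply locally_C_Cmod. exact (H eps).
Qed.

(** [C] is a normed module over itself in two ways with the same norm. The product and chain rules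
    produce [AbsRing_NormedModule], whereas [analytic_in_unit_disk] and [is_C_derive_unique] speak
    of [C_NormedModule]; the proof works with the former and crosses over here. *)
Lemma Cder_is_derive (f : C -> C) (z l : C) :
  Cder f z l <-> is_derive (K := C_AbsRing) (V := C_NormedModule) f z l.
Proof.
  split; intros [_ H]; split; try exact H.
  - exact (is_linear_scal_l (K := C_AbsRing) (V := C_NormedModule) l).
  - exact (is_linear_scal_l (K := C_AbsRing)
               (V := AbsRing_NormedModule C_AbsRing) l).
Qed.

Lemma Cder_C_derive (f : C -> C) (z l : C) : Cder f z l -> C_derive f z = l.
Proof. intros H. apply is_C_derive_unique, Cder_is_derive, H. Qed.

Lemma Cder_ext_loc (f g : C -> C) (z l : C) (r : R) :
  Cmod z < r -> (forall y, Cmod y < r -> f y = g y) -> Cder f z l -> Cder g z l.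
Proof.
  intros Hz E. apply is_derive_ext_loc. apply locally_C_Cmod.
  assert (Hd : 0 < r - Cmod z) by lra.
  exists (mkposreal _ Hd). intros y Hy. simpl in Hy. apply E.
  replace y with ((y - z) + z)%C by ring.
  pose proof (Cmod_triangle (y - z) z). lra.
Qed.

Lemma Cder_val (f : C -> C) (z l l' : C) : l = l' -> Cder f z l -> Cder f z l'.
Proof. intros ->. exact (fun H => H). Qed.

Lemma Cder_const (c z : C) : Cder (fun _ => c) z (RtoC 0).
Proof. exact (is_derive_const (K := C_AbsRing) (V := AbsRing_NormedModule C_AbsRing) c z). Qed.

Lemma Cder_id (z : C) : Cder (fun y => y) z (RtoC 1).
Proof. exact (is_derive_id (K := C_AbsRing) z). Qed.

Lemma Cder_plus (f g : C -> C) (z l m : C) :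
  Cder f z l -> Cder g z m -> Cder (fun y => f y + g y)%C z (l + m)%C.
Proof.
  exact (is_derive_plus (K := C_AbsRing) (V := AbsRing_NormedModule C_AbsRing) f g z l m).
Qed.

Lemma Cder_mult (f g : C -> C) (z l m : C) :
  Cder f z l -> Cder g z m ->
  Cder (fun y => f y * g y)%C z (l * g z + f z * m)%C.
Proof.
  intros Hf Hg.
  exact (is_derive_mult (K := C_AbsRing) f g z l m Hf Hg Cmult_comm).
Qed.

Lemma Cder_comp (f g : C -> C) (z l m : C) :
  Cder f (g z) l -> Cder g z m -> Cder (fun y => f (g y)) z (m * l)%C.
Proof.
  intros Hf Hg.
  exact (is_derive_comp (K := C_AbsRing) (V := AbsRing_NormedModule C_AbsRing) f g z l m Hf Hg).
Qed.

Lemma Cder_Cinv (z : C) : z <> RtoC 0 -> Cder Cinv z (- / (z * z))%C.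
Proof.
  intros Hz. apply Cder_eps. intros eps.
  pose proof (proj1 (Cmod_gt_0 z) Hz) as Hp. set (m := Cmod z) in *.
  (* The first bound keeps [|y| >= m / 2]; with it, the second makes the exact remainder
     [(y - z)^2 / (y z^2)] at most [eps |y - z|]. *)
  assert (Hd : 0 < Rmin (m / 2) (eps * m ^ 3 / 2)).
  { apply Rmin_glb_lt; [lra|]. pose proof (cond_pos eps).
    apply Rdiv_lt_0_compat; [|lra]. apply Rmult_lt_0_compat; [lra|]. now apply pow_lt. }
  exists (mkposreal _ Hd). intros y Hy; cbn [pos] in Hy.
  pose proof (Rmin_l (m / 2) (eps * m ^ 3 / 2)).
  pose proof (Rmin_r (m / 2) (eps * m ^ 3 / 2)).
  assert (Hy2 : m / 2 <= Cmod y).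
  { pose proof (Cmod_triangle y (z - y)) as T.
    replace (y + (z - y))%C with z in T by ring.
    replace (z - y)%C with (- (y - z))%C in T by ring.
    rewrite Cmod_opp in T. fold m in T. lra. }
  assert (Hy0 : y <> RtoC 0) by (apply Cmod_gt_0; lra).
  replace (/ y - / z - (y - z) * - / (z * z))%C
    with ((y - z) * (y - z) * / (y * (z * z)))%C by (field; auto).
  rewrite !Cmod_mult, Cmod_inv by (repeat apply Cmult_neq_0; auto).
  rewrite !Cmod_mult. fold m.
  set (d := Cmod (y - z)) in *. pose proof (Cmod_ge_0 (y - z)) as Hd0. fold d in Hd0.
  assert (Hq : d * / (Cmod y * (m * m)) <= eps).
  { assert (Hmm : 0 < m * m) by (now apply Rmult_lt_0_compat).
    assert (Hpos : 0 < Cmod y * (m * m)) by (apply Rmult_lt_0_compat; lra).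
    apply Rmult_le_reg_r with (Cmod y * (m * m)); [exact Hpos|].
    - rewrite Rmult_assoc, Rinv_l by lra.
      assert (eps * m ^ 3 / 2 <= eps * (Cmod y * (m * m))).
      { pose proof (cond_pos eps). replace (eps * m ^ 3 / 2) with (eps * (m / 2 * (m * m))) by field.
        apply Rmult_le_compat_l; [lra|]. apply Rmult_le_compat_r; lra. }
      lra. }
  replace (d * d * / (Cmod y * (m * m))) with (d * / (Cmod y * (m * m)) * d) by ring.
  apply Rmult_le_compat_r; lra.
Qed.

Lemma Cder_inv (f : C -> C) (z l : C) : f z <> RtoC 0 -> Cder f z l ->
  Cder (fun y => / f y)%C z (l * - / (f z * f z))%C.
Proof. intros H0 Hf. apply (Cder_comp Cinv f); [now apply Cder_Cinv | exact Hf]. Qed.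

(** * Continuity of complex-valued maps *)

Section Continuity.
Context {T : UniformSpace}.
Implicit Types f g : T -> C.

(** The domain [T] is left general because the same rules serve curves, two-parameter families on
    [R * R] and maps on [C]. *)
Lemma ccont_pair f (x : T) :
  continuous (fun y => Re (f y)) x -> continuous (fun y => Im (f y)) x -> ccont f x.
Proof.
  intros H1 H2 P [e He].
  pose proof (H1 _ (ex_intro _ e (fun y h => h))) as A.
  pose proof (H2 _ (ex_intro _ e (fun y h => h))) as B.
  unfold filtermap in *. generalize (filter_and _ _ A B). apply filter_imp.
  intros y [Ya Yb]. apply He. split; assumption.
Qed.

Lemma ccont_Re f (x : T) : ccont f x -> continuous (fun y => Re (f y)) x.
Proof.
  intros H P [e He]. 
  pose proof (H (fun c => P (Re c))) as A. apply A.
  exists e. intros y [Hy _]. apply He, Hy.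
Qed.

Lemma ccont_Im f (x : T) : ccont f x -> continuous (fun y => Im (f y)) x.
Proof.
  intros H P [e He]. 
  pose proof (H (fun c => P (Im c))) as A. apply A.
  exists e. intros y [_ Hy]. apply He, Hy.
Qed.

Lemma ccont_const (c : C) (x : T) : ccont (fun _ => c) x.
Proof. apply continuous_const. Qed.

Lemma ccont_plus f g (x : T) : ccont f x -> ccont g x -> ccont (fun y => f y + g y)%C x.
Proof.
  intros Hf Hg. apply ccont_pair.
  - apply (continuous_plus (fun y => Re (f y)) (fun y => Re (g y))); now apply ccont_Re.
  - apply (continuous_plus (fun y => Im (f y)) (fun y => Im (g y))); now apply ccont_Im.
Qed.

Lemma ccont_mult f g (x : T) : ccont f x -> ccont g x -> ccont (fun y => f y * g y)%C x.
Proof.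
  intros Hf Hg.
  pose proof (ccont_Re _ _ Hf). pose proof (ccont_Re _ _ Hg).
  pose proof (ccont_Im _ _ Hf). pose proof (ccont_Im _ _ Hg).
  apply ccont_pair.
  - apply (continuous_minus (fun y => Re (f y) * Re (g y)) (fun y => Im (f y) * Im (g y)));
      apply (continuous_mult (K := R_AbsRing)); assumption.
  - apply (continuous_plus (fun y => Re (f y) * Im (g y)) (fun y => Im (f y) * Re (g y)));
      apply (continuous_mult (K := R_AbsRing)); assumption.
Qed.

Lemma ccont_conj f (x : T) : ccont f x -> ccont (fun y => Cconj (f y)) x.
Proof.
  intros Hf. apply ccont_pair; [exact (ccont_Re _ _ Hf)|].
  apply (continuous_opp (fun y => Im (f y))). now apply ccont_Im.
Qed.

Lemma ccont_pow f (n : nat) (x : T) : ccont f x -> ccont (fun y => f y ^ n)%C x.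
Proof.
  intros Hf. induction n as [|n IH]; [apply ccont_const|].
  now apply (ccont_mult f (fun y => f y ^ n)%C).
Qed.

Lemma ccont_inv f (x : T) : f x <> RtoC 0 -> ccont f x -> ccont (fun y => / f y)%C x.
Proof.
  intros H0 Hf.
  pose proof (ccont_Re _ _ Hf) as H1. pose proof (ccont_Im _ _ Hf) as H2.
  assert (Hi : continuous (fun y => / (Re (f y) ^ 2 + Im (f y) ^ 2)) x).
  { apply (continuous_comp (fun y => Re (f y) ^ 2 + Im (f y) ^ 2) Rinv).
    - apply (continuous_plus (fun y => Re (f y) ^ 2) (fun y => Im (f y) ^ 2));
      simpl; repeat (apply (continuous_mult (K := R_AbsRing)); try assumption);
      apply continuous_const.
    - apply continuous_Rinv. rewrite <- Cmod2_alt.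
      apply pow_nonzero, Rgt_not_eq, Cmod_gt_0, H0. }
  apply ccont_pair.
  - apply (continuous_mult (K := R_AbsRing)); assumption.
  - apply (continuous_mult (K := R_AbsRing)); [|assumption].
    now apply (continuous_opp (fun y => Im (f y))).
Qed.

Lemma ccont_comp (h : C -> C) f (x : T) :
  continuous (T := C_UniformSpace) (U := C_UniformSpace) h (f x) -> ccont f x ->
  ccont (fun y => h (f y)) x.
Proof. intros Hh Hf. apply (continuous_comp f h); assumption. Qed.

Lemma ccont_RtoC (u : T -> R) (x : T) : continuous u x -> ccont (fun y => RtoC (u y)) x.
Proof. intros H. apply ccont_pair; [exact H|]. apply continuous_const. Qed.

End Continuity.

(** Differentiability is measured by the modulus, continuity by the product uniform structure of
    [C]. Comparing the two costs a factor [sqrt 2], rounded up to the [2] in [K]. *)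
Lemma Cder_ccont (f : C -> C) (z l : C) :
  Cder f z l -> continuous (T := C_UniformSpace) (U := C_UniformSpace) f z.
Proof.
  intros H. rewrite Cder_eps in H.
  apply (filterlim_locally (U := C_UniformSpace)). intros e.
  destruct (H (mkposreal 1 Rlt_0_1)) as [d Hd]. simpl in Hd.
  set (K := 2 * (1 + Cmod l)). pose proof (Cmod_ge_0 l) as Hl.
  assert (Hm : 0 < Rmin (d / 2) (e / K)).
  { pose proof (cond_pos d). pose proof (cond_pos e).
    apply Rmin_glb_lt; [lra|]. apply Rdiv_lt_0_compat; unfold K; lra. }
  exists (mkposreal _ Hm). intros y Hy.
  pose proof (C_NormedModule_mixin_compat2 z y (mkposreal _ Hm) Hy) as Hy2.
  change (Cmod (y - z) < sqrt 2 * Rmin (d / 2) (e / K)) in Hy2.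
  assert (Hs : sqrt 2 < 2).
  { rewrite <- (sqrt_square 2) at 2 by lra. apply sqrt_lt_1; lra. }
  pose proof (Rmin_l (d / 2) (e / K)). pose proof (Rmin_r (d / 2) (e / K)).
  assert (Hy3 : Cmod (y - z) < 2 * Rmin (d / 2) (e / K)) by nra.
  apply C_NormedModule_mixin_compat1.
  change (Cmod (f y - f z) < e).
  assert (Hyd : Cmod (y - z) < d) by lra.
  specialize (Hd y Hyd).
  pose proof (Cmod_triangle (f y - f z - (y - z) * l) ((y - z) * l)) as T.
  replace (f y - f z - (y - z) * l + (y - z) * l)%C with (f y - f z)%C in T by ring.
  rewrite Cmod_mult in T.
  assert (Cmod (y - z) * (1 + Cmod l) < e).
  { assert (e / K * K = e) by (field; unfold K; lra).
    unfold K in *. nra. }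
  lra.
Qed.

(** * Differentiable curves in the plane *)

(** Componentwise, so that the real fundamental theorem of calculus and differentiation under a real
    integral apply to each part. *)
Definition curve_der (g : R -> C) (t : R) (v : C) : Prop :=
  is_derive (fun s => Re (g s)) t (Re v) /\ is_derive (fun s => Im (g s)) t (Im v).

Lemma is_derive_R_eps (u : R -> R) (t l : R) :
  is_derive u t l <->
  forall eps : posreal, exists d : posreal, forall s : R, Rabs (s - t) < d ->
    Rabs (u s - u t - (s - t) * l) <= eps * Rabs (s - t).
Proof.
  split.
  - intros [_ H] eps. specialize (H t (fun P HP => HP) eps). exact H.
  - intros H. split.
    + exact (is_linear_scal_l (K := R_AbsRing) (V := R_NormedModule) l).
    + intros x Hx.
      assert (Ex : t = x).
      { apply (@is_filter_lim_locally_unique R_AbsRing R_NormedModule). exact Hx. }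
      subst x. intros eps. exact (H eps).
Qed.

Lemma Rabs_Im_le (c : C) : Rabs (Im c) <= Cmod c.
Proof. eapply Rle_trans; [apply Rmax_r | apply (Rmax_Cmod c)]. Qed.

Lemma Cmod_le_Re_Im (c : C) : Cmod c <= Rabs (Re c) + Rabs (Im c).
Proof.
  replace c with (RtoC (Re c) + Ci * RtoC (Im c))%C at 1.
  - eapply Rle_trans; [apply Cmod_triangle|].
    rewrite Cmod_mult, Cmod_Ci, !Cmod_R. lra.
  - destruct c as [a b]. unfold RtoC, Ci, Cplus, Cmult; simpl. f_equal; ring.
Qed.

Lemma curve_der_eps (g : R -> C) (t : R) (v : C) :
  curve_der g t v <->
  forall eps : posreal, exists d : posreal, forall s : R, Rabs (s - t) < d ->
    Cmod (g s - g t - RtoC (s - t) * v) <= eps * Rabs (s - t).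
Proof.
  assert (ER : forall s, Re (g s - g t - RtoC (s - t) * v) = Re (g s) - Re (g t) - (s - t) * Re v)
    by (intros s; unfold Cminus; rewrite !re_plus, !re_opp, re_scal_l; ring).
  assert (EI : forall s, Im (g s - g t - RtoC (s - t) * v) = Im (g s) - Im (g t) - (s - t) * Im v)
    by (intros s; unfold Cminus; rewrite !im_plus, !im_opp, im_scal_l; ring).
  unfold curve_der. rewrite !is_derive_R_eps. split.
  - intros [H1 H2] eps.
    destruct (H1 (pos_div_2 eps)) as [d1 D1]. destruct (H2 (pos_div_2 eps)) as [d2 D2].
    assert (Hd : 0 < Rmin d1 d2) by (apply Rmin_glb_lt; apply cond_pos).
    exists (mkposreal _ Hd). intros s Hs. cbn [pos] in Hs.
    change (pos (pos_div_2 eps)) with (eps / 2) in *.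
    specialize (D1 s (Rlt_le_trans _ _ _ Hs (Rmin_l _ _))).
    specialize (D2 s (Rlt_le_trans _ _ _ Hs (Rmin_r _ _))).
    eapply Rle_trans; [apply Cmod_le_Re_Im|]. rewrite ER, EI. lra.
  - intros H. split; intros eps; destruct (H eps) as [d D]; exists d; intros s Hs;
      (eapply Rle_trans; [| apply (D s Hs)]).
    + rewrite <- ER. apply re_le_Cmod.
    + rewrite <- EI. apply Rabs_Im_le.
Qed.

(** The error is the remainder of [h] plus [l] times the remainder of [g]; the constants [K] and [L]
    allot half of [eps] to each. *)
Lemma curve_der_comp (h : C -> C) (g : R -> C) (t : R) (l v : C) :
  Cder h (g t) l -> curve_der g t v -> curve_der (fun s => h (g s)) t (v * l)%C.
Proof.
  intros Hh Hg. rewrite curve_der_eps in *. rewrite Cder_eps in Hh. intros eps.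
  pose proof (Cmod_ge_0 l) as Hl. pose proof (Cmod_ge_0 v) as Hv.
  pose proof (cond_pos eps) as Pe.
  set (K := 2 * (1 + Cmod v)). assert (HK : 0 < K) by (unfold K; lra).
  set (L := 2 * (1 + Cmod l)). assert (HL : 0 < L) by (unfold L; lra).
  assert (He1 : 0 < eps / K) by (apply Rdiv_lt_0_compat; lra).
  destruct (Hh (mkposreal _ He1)) as [d1 D1].
  assert (He2 : 0 < Rmin 1 (eps / L)).
  { apply Rmin_glb_lt; [lra|apply Rdiv_lt_0_compat; lra]. }
  destruct (Hg (mkposreal _ He2)) as [d2 D2]. simpl in *.
  assert (Hd : 0 < Rmin d2 (d1 / (1 + Cmod v))).
  { apply Rmin_glb_lt; [apply cond_pos|].
    apply Rdiv_lt_0_compat; [apply cond_pos | lra]. }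
  exists (mkposreal _ Hd). intros s Hs. simpl in Hs.
  pose proof (Rmin_l d2 (d1 / (1 + Cmod v))). pose proof (Rmin_r d2 (d1 / (1 + Cmod v))).
  pose proof (Rmin_l 1 (eps / L)). pose proof (Rmin_r 1 (eps / L)).
  assert (Hs2 : Rabs (s - t) < d2) by lra. specialize (D2 s Hs2).
  set (a := Rabs (s - t)) in *. pose proof (Rabs_pos (s - t)) as Ha. fold a in Ha.
  assert (B : Cmod (g s - g t) <= (1 + Cmod v) * a).
  { pose proof (Cmod_triangle (g s - g t - RtoC (s - t) * v) (RtoC (s - t) * v)) as T.
    replace (g s - g t - RtoC (s - t) * v + RtoC (s - t) * v)%C with (g s - g t)%C in T by ring.
    rewrite Cmod_mult, Cmod_R in T. fold a in T. nra. }
  assert (B1 : Cmod (g s - g t) < d1).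
  { assert (d1 / (1 + Cmod v) * (1 + Cmod v) = d1) by (field; lra). nra. }
  specialize (D1 _ B1).
  replace (h (g s) - h (g t) - RtoC (s - t) * (v * l))%C
    with ((h (g s) - h (g t) - (g s - g t) * l) + (g s - g t - RtoC (s - t) * v) * l)%C by ring.
  eapply Rle_trans; [apply Cmod_triangle|]. rewrite (Cmod_mult _ l).
  assert (X1 : eps / K * Cmod (g s - g t) <= eps / 2 * a).
  { apply Rle_trans with (eps / K * ((1 + Cmod v) * a)).
    - apply Rmult_le_compat_l; lra.
    - right. unfold K. field. lra. }
  assert (X2 : Cmod (g s - g t - RtoC (s - t) * v) * Cmod l <= eps / 2 * a).
  { apply Rle_trans with (eps / L * a * (1 + Cmod l)).
    - apply Rmult_le_compat; try apply Cmod_ge_0; try lra.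
      eapply Rle_trans; [apply D2|]. apply Rmult_le_compat_r; lra.
    - right. unfold L. field. lra. }
  lra.
Qed.

(** * Holomorphic functions on a disk *)

(** Continuity of the derivative belongs to the notion because Cauchy's formula is obtained by
    differentiating under the integral sign. *)
Definition holo (R0 : R) (h : C -> C) : Prop :=
  exists h' : C -> C, forall z : C, Cmod z < R0 ->
    Cder h z (h' z) /\ continuous (T := C_UniformSpace) (U := C_UniformSpace) h' z.

Lemma holo_ccont (R0 : R) (h : C -> C) (z : C) : holo R0 h -> Cmod z < R0 ->
  continuous (T := C_UniformSpace) (U := C_UniformSpace) h z.
Proof. intros [h' H] Hz. apply (Cder_ccont h z (h' z)), H, Hz. Qed.

Lemma holo_const (R0 : R) (c : C) : holo R0 (fun _ => c).
Proof.
  exists (fun _ => RtoC 0). intros z _. split; [apply Cder_const | apply continuous_const].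
Qed.

Lemma holo_id (R0 : R) : holo R0 (fun z => z).
Proof.
  exists (fun _ => RtoC 1). intros z _. split; [apply Cder_id | apply continuous_const].
Qed.

Lemma holo_plus (R0 : R) (f g : C -> C) :
  holo R0 f -> holo R0 g -> holo R0 (fun z => f z + g z)%C.
Proof.
  intros [f' Hf] [g' Hg]. exists (fun z => f' z + g' z)%C. intros z Hz.
  destruct (Hf z Hz), (Hg z Hz). split; [now apply Cder_plus | now apply ccont_plus].
Qed.

Lemma holo_mult (R0 : R) (f g : C -> C) :
  holo R0 f -> holo R0 g -> holo R0 (fun z => f z * g z)%C.
Proof.
  intros [f' Hf] [g' Hg]. exists (fun z => f' z * g z + f z * g' z)%C. intros z Hz.
  destruct (Hf z Hz) as [F1 F2], (Hg z Hz) as [G1 G2]. split; [now apply Cder_mult|].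
  apply Cder_ccont in F1. apply Cder_ccont in G1.
  apply ccont_plus; now apply ccont_mult.
Qed.

Lemma holo_inv (R0 : R) (f : C -> C) :
  (forall z, Cmod z < R0 -> f z <> RtoC 0) -> holo R0 f -> holo R0 (fun z => / f z)%C.
Proof.
  intros H0 [f' Hf]. exists (fun z => f' z * - / (f z * f z))%C. intros z Hz.
  destruct (Hf z Hz) as [F1 F2]. specialize (H0 z Hz). split; [now apply Cder_inv|].
  apply Cder_ccont in F1. apply ccont_mult; [exact F2|].
  apply (ccont_comp Copp).
  - apply (Cder_ccont Copp _ (- RtoC 1)%C).
    apply (is_derive_opp (K := C_AbsRing) (V := AbsRing_NormedModule C_AbsRing) (fun z => z)).
    apply Cder_id.
  - apply (ccont_inv (fun y => f y * f y)%C); [now apply Cmult_neq_0 | now apply ccont_mult].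
Qed.

Lemma holo_pow (R0 : R) (n : nat) : holo R0 (fun z => z ^ n)%C.
Proof.
  induction n as [|n IH]; [exact (holo_const R0 (RtoC 1))|].
  apply (holo_mult R0 (fun z => z) (fun z => z ^ n)%C); [apply holo_id | exact IH].
Qed.

(** * Means over the unit circle *)

Definition circ (t : R) : C := (cos t, sin t).

Lemma circ_conj_mult (t : R) : (circ t * Cconj (circ t))%C = RtoC 1.
Proof.
  unfold circ, Cconj, Cmult, RtoC; simpl. f_equal; [|ring].
  pose proof (sin2_cos2 t) as H. unfold Rsqr in H. lra.
Qed.

Lemma Cmod_circ (t : R) : Cmod (circ t) = 1.
Proof.
  transitivity (sqrt 1); [|apply sqrt_1]. unfold Cmod, circ; simpl. f_equal.
  pose proof (sin2_cos2 t) as H. unfold Rsqr in H. lra.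
Qed.

Lemma circ_neq_0 (t : R) : circ t <> RtoC 0.
Proof. apply Cmod_gt_0. rewrite Cmod_circ. lra. Qed.

Lemma circ_minus_neq_0 (t : R) (w : C) : Cmod w < 1 -> (circ t - w)%C <> RtoC 0.
Proof.
  intros Hw E. assert (E' : circ t = w).
  { replace (circ t) with ((circ t - w) + w)%C by ring. rewrite E. ring. }
  rewrite <- E', Cmod_circ in Hw. lra.
Qed.

Lemma ccont_circ (t : R) : ccont circ t.
Proof. apply ccont_pair; [apply continuous_cos | apply continuous_sin]. Qed.

Lemma curve_der_circ (t : R) : curve_der circ t (Ci * circ t)%C.
Proof.
  unfold circ, Ci, Cmult; split; simpl; auto_derive; auto; ring.
Qed.

Lemma circ_2PI : circ (2 * PI) = circ 0.
Proof. unfold circ. now rewrite cos_2PI, sin_2PI, cos_0, sin_0. Qed.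

Definition rmean (u : R -> R) : R := RInt u 0 (2 * PI) / (2 * PI).

Definition cmean (F : R -> C) : C :=
  (rmean (fun t => Re (F t)), rmean (fun t => Im (F t))).

Definition rcts (u : R -> R) : Prop := forall t, continuous u t.
Definition ccts (F : R -> C) : Prop := forall t, ccont F t.

Lemma rcts_ex_RInt (u : R -> R) (a b : R) : rcts u -> ex_RInt u a b.
Proof. intros H. apply (ex_RInt_continuous (V := R_CompleteNormedModule)). intros; apply H. Qed.

Lemma ccts_Re (F : R -> C) : ccts F -> rcts (fun t => Re (F t)).
Proof. intros H t. apply ccont_Re, H. Qed.

Lemma ccts_Im (F : R -> C) : ccts F -> rcts (fun t => Im (F t)).
Proof. intros H t. apply ccont_Im, H. Qed.

Lemma two_PI_pos : 0 < 2 * PI.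
Proof. pose proof PI_RGT_0. lra. Qed.

Lemma rmean_ext (u v : R -> R) : (forall t, u t = v t) -> rmean u = rmean v.
Proof. intros H. unfold rmean. f_equal. apply RInt_ext. intros; apply H. Qed.

Lemma rmean_plus (u v : R -> R) : rcts u -> rcts v ->
  rmean (fun t => u t + v t) = rmean u + rmean v.
Proof.
  intros Hu Hv. unfold rmean.
  rewrite (RInt_plus u v) by now apply rcts_ex_RInt.
  unfold plus; simpl. field. apply Rgt_not_eq, PI_RGT_0.
Qed.

Lemma rmean_scal (c : R) (u : R -> R) : rcts u -> rmean (fun t => c * u t) = c * rmean u.
Proof.
  intros Hu. unfold rmean.
  transitivity (c * RInt u 0 (2 * PI) / (2 * PI)).
  - f_equal. apply (RInt_scal (V := R_CompleteNormedModule) u 0 (2 * PI) c).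
    now apply rcts_ex_RInt.
  - field. apply Rgt_not_eq, PI_RGT_0.
Qed.

Lemma rmean_const (c : R) : rmean (fun _ => c) = c.
Proof.
  unfold rmean. rewrite RInt_const. unfold scal; simpl; unfold mult; simpl.
  field. apply Rgt_not_eq, PI_RGT_0.
Qed.

Lemma rmean_le (u v : R -> R) : rcts u -> rcts v -> (forall t, u t <= v t) ->
  rmean u <= rmean v.
Proof.
  intros Hu Hv H. unfold rmean, Rdiv. pose proof two_PI_pos.
  apply Rmult_le_compat_r; [left; now apply Rinv_0_lt_compat|].
  apply RInt_le; [lra | now apply rcts_ex_RInt .. |]. intros; apply H.
Qed.

Lemma rcts_scal (c : R) (u : R -> R) : rcts u -> rcts (fun t => c * u t).
Proof. intros Hu t. apply (continuous_scal_r c u); auto. Qed.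

Lemma cmean_ext (F G : R -> C) : (forall t, F t = G t) -> cmean F = cmean G.
Proof. intros H. unfold cmean. f_equal; apply rmean_ext; intros; now rewrite H. Qed.

Lemma cmean_plus (F G : R -> C) : ccts F -> ccts G ->
  cmean (fun t => F t + G t)%C = (cmean F + cmean G)%C.
Proof.
  intros HF HG. unfold cmean, Cplus; simpl. f_equal.
  - apply (rmean_plus (fun t => Re (F t)) (fun t => Re (G t))); now apply ccts_Re.
  - apply (rmean_plus (fun t => Im (F t)) (fun t => Im (G t))); now apply ccts_Im.
Qed.

Lemma cmean_scal (c : C) (F : R -> C) : ccts F ->
  cmean (fun t => c * F t)%C = (c * cmean F)%C.
Proof.
  intros HF. pose proof (ccts_Re _ HF). pose proof (ccts_Im _ HF).
  transitivity (Re (c * cmean F)%C, Im (c * cmean F)%C); [|now destruct (c * cmean F)%C].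
  rewrite re_mult, im_mult. unfold cmean at 1. f_equal.
  - rewrite (rmean_ext _ (fun t => Re c * Re (F t) + - Im c * Im (F t))).
    + rewrite rmean_plus, !rmean_scal; auto using rcts_scal. unfold cmean; simpl. ring.
    + intros t. rewrite re_mult. ring.
  - rewrite (rmean_ext _ (fun t => Re c * Im (F t) + Im c * Re (F t))).
    + rewrite rmean_plus, !rmean_scal; auto using rcts_scal.
    + intros t. rewrite im_mult. ring.
Qed.

Lemma cmean_conj (F : R -> C) : ccts F -> cmean (fun t => Cconj (F t)) = Cconj (cmean F).
Proof.
  intros HF. unfold cmean; unfold Cconj at 3; cbn [fst snd]. f_equal.
  rewrite (rmean_ext _ (fun t => (-1) * Im (F t))).
  - rewrite rmean_scal by now apply ccts_Im. unfold Im. ring.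
  - intros t. rewrite im_conj. ring.
Qed.

Lemma cmean_const (c : C) : cmean (fun _ => c) = c.
Proof. unfold cmean. rewrite !rmean_const. now destruct c. Qed.

Lemma ccts_RtoC (u : R -> R) : rcts u -> ccts (fun t => RtoC (u t)).
Proof. intros H t. now apply ccont_RtoC. Qed.

Lemma ccts_plus (F G : R -> C) : ccts F -> ccts G -> ccts (fun t => F t + G t)%C.
Proof. intros HF HG t. now apply ccont_plus. Qed.

Lemma ccts_mult (F G : R -> C) : ccts F -> ccts G -> ccts (fun t => F t * G t)%C.
Proof. intros HF HG t. now apply ccont_mult. Qed.

Lemma ccts_conj (F : R -> C) : ccts F -> ccts (fun t => Cconj (F t)).
Proof. intros HF t. now apply ccont_conj. Qed.

Lemma ccts_const (c : C) : ccts (fun _ => c).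
Proof. intros t. apply ccont_const. Qed.

Lemma ccts_holo (R0 : R) (h : C -> C) : 1 < R0 -> holo R0 h -> ccts (fun t => h (circ t)).
Proof.
  intros H1 Hh t. apply ccont_comp; [|apply ccont_circ].
  apply (holo_ccont R0); [exact Hh|]. rewrite Cmod_circ. exact H1.
Qed.

(* Rotate the mean onto the positive real axis; then only real parts matter. *)
Lemma Cmod_cmean_le (u : R -> R) (F : R -> C) (M : R) :
  rcts u -> ccts F -> (forall t, 0 <= u t) -> (forall t, Cmod (F t) <= M) ->
  Cmod (cmean (fun t => RtoC (u t) * F t)%C) <= M * rmean u.
Proof.
  intros Hu HF Hpos HM.
  assert (HuF : ccts (fun t => RtoC (u t) * F t)%C) by (apply ccts_mult; auto using ccts_RtoC).
  set (I := cmean (fun t => RtoC (u t) * F t)%C).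
  destruct (Ceq_dec I (RtoC 0)) as [E|Hne].
  - rewrite E, Cmod_0. apply Rmult_le_pos.
    + eapply Rle_trans; [apply Cmod_ge_0 | apply (HM 0)].
    + rewrite <- (rmean_const 0). apply rmean_le; auto. intros t; apply continuous_const.
  - pose proof (proj1 (Cmod_gt_0 I) Hne) as Hp.
    set (c := (Cconj I * RtoC (/ Cmod I))%C).
    assert (Hc : Cmod c = 1).
    { unfold c. rewrite Cmod_mult, Cmod_conj, Cmod_R, Rabs_pos_eq.
      - field. lra.
      - left. now apply Rinv_0_lt_compat. }
    assert (HcI : (c * I)%C = RtoC (Cmod I)).
    { unfold c. replace (Cconj I * RtoC (/ Cmod I) * I)%C
        with (RtoC (/ Cmod I) * (I * Cconj I))%C by ring.
      rewrite <- Cmod2_conj, <- RtoC_mult. f_equal. field. lra. }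
    replace (Cmod I) with (Re (c * I)%C) by (rewrite HcI; apply re_RtoC).
    unfold I. rewrite <- cmean_scal by exact HuF.
    change (rmean (fun t => Re (c * (RtoC (u t) * F t))) <= M * rmean u).
    rewrite <- rmean_scal by exact Hu. apply rmean_le.
    + apply ccts_Re, ccts_mult; [apply ccts_const | exact HuF].
    + now apply rcts_scal.
    + intros t. eapply Rle_trans; [apply Rle_abs|].
      eapply Rle_trans; [apply re_le_Cmod|].
      rewrite !Cmod_mult, Hc, Cmod_R, Rabs_pos_eq by apply Hpos.
      specialize (Hpos t). specialize (HM t). nra.
Qed.

(** * Cauchy's formula on the unit circle *)

Lemma cmean_curve_der (G X : R -> C) :
  (forall t, curve_der G t (X t)) -> ccts X -> G (2 * PI) = G 0 -> cmean X = RtoC 0.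
Proof.
  intros HG HX E. unfold cmean, rmean, RtoC. f_equal.
  - rewrite (is_RInt_unique (fun t => Re (X t)) 0 (2 * PI) 0); [lra|].
    replace 0 with (minus (Re (G (2 * PI))) (Re (G 0))) at 2
      by (rewrite E; apply (minus_eq_zero (G := R_AbelianGroup))).
    apply (is_RInt_derive (V := R_CompleteNormedModule) (fun t => Re (G t))).
    + intros t _. apply HG.
    + intros t _. now apply ccts_Re.
  - rewrite (is_RInt_unique (fun t => Im (X t)) 0 (2 * PI) 0); [lra|].
    replace 0 with (minus (Im (G (2 * PI))) (Im (G 0))) at 2
      by (rewrite E; apply (minus_eq_zero (G := R_AbelianGroup))).
    apply (is_RInt_derive (V := R_CompleteNormedModule) (fun t => Im (G t))).
    + intros t _. apply HG.
    + intros t _. now apply ccts_Im.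
Qed.

(** [is_derive_RInt_param] is phrased with [Derive]; here the partial derivative is an explicit
    function [du], jointly continuous on the strip [a < s < b]. *)
Lemma is_derive_rmean_param (u du : R -> R -> R) (a b t : R) : a < t < b ->
  (forall s x, a < s < b -> is_derive (fun r => u r x) s (du s x)) ->
  (forall s x, a < s < b -> continuous (fun p : R * R => du (fst p) (snd p)) (s, x)) ->
  (forall s, a < s < b -> rcts (u s)) ->
  is_derive (fun s => rmean (u s)) t (rmean (du t)).
Proof.
  intros Ht Hd Hc Hu.
  assert (Hloc : forall s, a < s < b -> locally s (fun r => a < r < b)).
  { intros s Hs. exact (open_and _ _ (open_gt a) (open_lt b) s Hs). }
  unfold rmean, Rdiv.
  assert (Hint : is_derive (fun s => RInt (u s) 0 (2 * PI)) t (RInt (du t) 0 (2 * PI))).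
  { rewrite (RInt_ext (du t) (fun x => Derive (fun r => u r x) t))
      by (intros x _; symmetry; now apply is_derive_unique, Hd).
    apply is_derive_RInt_param.
    - generalize (Hloc t Ht). apply filter_imp. intros s Hs x _.
      exists (du s x). now apply Hd.
    - intros x _. apply continuity_2d_pt_ext_loc with du.
      + destruct (Hloc t Ht) as [d Hdl]. exists d. intros r y Hr _.
        symmetry. apply is_derive_unique, Hd, Hdl, Hr.
      + apply continuity_2d_pt_filterlim. now apply Hc.
    - generalize (Hloc t Ht). apply filter_imp. intros s Hs. now apply rcts_ex_RInt, Hu. }
  apply is_derive_ext with (fun s => / (2 * PI) * RInt (u s) 0 (2 * PI)).
  { intros s. apply Rmult_comm. }
  rewrite (Rmult_comm (RInt _ _ _)). now apply (is_derive_scal (fun s => RInt (u s) 0 (2 * PI))).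
Qed.

Lemma curve_der_cmean_param (F dF : R -> R -> C) (a b t : R) : a < t < b ->
  (forall s x, a < s < b -> curve_der (fun r => F r x) s (dF s x)) ->
  (forall s x, a < s < b -> ccont (fun p : R * R => dF (fst p) (snd p)) (s, x)) ->
  (forall s, a < s < b -> ccts (F s)) ->
  curve_der (fun s => cmean (F s)) t (cmean (dF t)).
Proof.
  intros Ht Hd Hc Hu. split.
  - apply (is_derive_rmean_param (fun s x => Re (F s x)) (fun s x => Re (dF s x)) a b);
      intros; auto.
    + now apply Hd.
    + now apply ccont_Re, Hc.
    + now apply ccts_Re, Hu.
  - apply (is_derive_rmean_param (fun s x => Im (F s x)) (fun s x => Im (dF s x)) a b);
      intros; auto.
    + now apply Hd.
    + now apply ccont_Im, Hc.
    + now apply ccts_Im, Hu.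
Qed.

Lemma curve_der_0_eq (g : R -> C) (a b : R) : a < b ->
  (forall t, a <= t <= b -> curve_der g t (RtoC 0)) -> g a = g b.
Proof.
  intros Hab H. rewrite (surjective_pairing (g a)), (surjective_pairing (g b)). f_equal.
  - apply (eq_is_derive (fun t => Re (g t)) a b); [|exact Hab]. intros t Ht. now apply H.
  - apply (eq_is_derive (fun t => Im (g t)) a b); [|exact Hab]. intros t Ht. now apply H.
Qed.

Lemma curve_der_ext (g1 g2 : R -> C) (t : R) (v1 v2 : C) :
  (forall s, g1 s = g2 s) -> v1 = v2 -> curve_der g1 t v1 -> curve_der g2 t v2.
Proof.
  intros E <- [H1 H2]. split.
  - apply (is_derive_ext (fun s => Re (g1 s))); [intros s; now rewrite E | exact H1].
  - apply (is_derive_ext (fun s => Im (g1 s))); [intros s; now rewrite E | exact H2].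
Qed.

Lemma Cder_affine (k c z : C) : Cder (fun y => c + k * y)%C z k.
Proof.
  apply (Cder_val _ z (RtoC 0 + (RtoC 0 * z + k * RtoC 1))%C); [ring|].
  apply Cder_plus; [apply Cder_const|].
  apply Cder_mult; [apply Cder_const | apply Cder_id].
Qed.

Lemma curve_der_RtoC (t : R) : curve_der RtoC t (RtoC 1).
Proof.
  split; [exact (is_derive_id (K := R_AbsRing) t)|].
  exact (is_derive_const (K := R_AbsRing) (V := R_NormedModule) 0 t).
Qed.

(** The point is [(1 - s) w + s zeta], of modulus at most [|1 - s| + |s|]. The margin [(R0 - 1) / 2]
    on either side of [[0, 1]] provides an open interval on which to differentiate in [s]. *)
Lemma segment_to_circle_bound (R0 : R) (w : C) (s t : R) : 1 < R0 -> Cmod w < 1 ->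
  - ((R0 - 1) / 2) < s < 1 + (R0 - 1) / 2 ->
  Cmod (w + RtoC s * (circ t - w)) < R0.
Proof.
  intros HR Hw Hs.
  replace (w + RtoC s * (circ t - w))%C with (RtoC (1 - s) * w + RtoC s * circ t)%C
    by (rewrite RtoC_minus; ring).
  eapply Rle_lt_trans; [apply Cmod_triangle|].
  rewrite !Cmod_mult, !Cmod_R, Cmod_circ.
  pose proof (Rabs_pos (1 - s)). pose proof (Cmod_ge_0 w).
  assert (Rabs (1 - s) * Cmod w <= Rabs (1 - s)) by nra.
  assert (Rabs (1 - s) + Rabs s < R0)
    by (unfold Rabs; destruct (Rcase_abs (1 - s)), (Rcase_abs s); lra).
  lra.
Qed.

(* The mean of [h (w + s (zeta - w)) zeta / (zeta - w)] does not depend on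
   [s]: its derivative in [s] is the mean of [h' (w + s (zeta - w)) zeta],
   which is the integral of an exact derivative along the circle. *)
Lemma cauchy_formula_aux (R0 : R) (h : C -> C) (w : C) :
  1 < R0 -> holo R0 h -> Cmod w < 1 ->
  cmean (fun t => h (circ t) * (circ t * / (circ t - w)))%C =
  cmean (fun t => h w * (circ t * / (circ t - w)))%C.
Proof.
  intros HR [h' Hh] Hw.
  set (K := fun t => (circ t * / (circ t - w))%C).
  set (gam := fun s t => (w + RtoC s * (circ t - w))%C).
  set (F := fun s t => (h (gam s t) * K t)%C).
  set (dF := fun s t => (h' (gam s t) * circ t)%C).
  set (e := (R0 - 1) / 2). assert (He : 0 < e) by (unfold e; lra).
  assert (Hg : forall s t, - e < s < 1 + e -> Cmod (gam s t) < R0)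
    by (intros s t Hs; now apply segment_to_circle_bound).
  assert (HKc : ccts K).
  { intros t. apply ccont_mult; [apply ccont_circ|].
    apply (ccont_inv (fun t => circ t - w)%C); [now apply circ_minus_neq_0|].
    apply ccont_plus; [apply ccont_circ | apply ccont_const]. }
  assert (Hgam2 : forall s t, ccont (fun p : R * R => gam (fst p) (snd p)) (s, t)).
  { intros s t. unfold gam. apply ccont_plus; [apply ccont_const|].
    apply ccont_mult.
    - apply ccont_RtoC, continuous_fst.
    - apply ccont_plus; [|apply ccont_const].
      apply (continuous_comp snd circ); [apply continuous_snd | apply ccont_circ]. }
  assert (Hgam1 : forall s t, ccont (gam s) t).
  { intros s t. unfold gam. apply ccont_plus; [apply ccont_const|].
    apply ccont_mult; [apply ccont_const|].
    apply ccont_plus; [apply ccont_circ | apply ccont_const]. }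
  assert (HdFc : forall s, - e < s < 1 + e -> ccts (dF s)).
  { intros s Hs t. apply ccont_mult; [|apply ccont_circ].
    apply (ccont_comp h' (gam s)); [now apply Hh, Hg | apply Hgam1]. }
  assert (D : forall s, - e < s < 1 + e -> curve_der (fun s => cmean (F s)) s (cmean (dF s))).
  { intros s Hs. apply (curve_der_cmean_param F dF (- e) (1 + e)); [exact Hs | | |].
    - clear s Hs. intros s t Hs. unfold F, dF.
      apply (curve_der_ext (fun r => (fun y => h y * K t)%C (gam r t)) _ s
               ((RtoC 1 * (circ t - w)) * (h' (gam s t) * K t))%C).
      + reflexivity.
      + unfold K. field. now apply circ_minus_neq_0.
      + apply (curve_der_comp (fun y => h y * K t)%C (fun r => gam r t)).
        * apply (Cder_val _ _ (h' (gam s t) * K t + h (gam s t) * RtoC 0)%C); [ring|].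
          apply Cder_mult; [now apply Hh, Hg | apply Cder_const].
        * apply (curve_der_ext (fun r => (fun y => w + (circ t - w) * y)%C (RtoC r)) _ s
                   (RtoC 1 * (circ t - w))%C).
          -- intros r. unfold gam. ring.
          -- reflexivity.
          -- apply (curve_der_comp (fun y => w + (circ t - w) * y)%C RtoC);
               [apply Cder_affine | apply curve_der_RtoC].
    - clear s Hs. intros s t Hs. unfold dF.
      apply ccont_mult.
      + apply (ccont_comp h' (fun p : R * R => gam (fst p) (snd p)));
          [now apply Hh, Hg | apply Hgam2].
      + apply (continuous_comp snd circ); [apply continuous_snd | apply ccont_circ].
    - clear s Hs. intros s Hs. apply ccts_mult; [|exact HKc].
      intros t. apply (ccont_comp h (gam s)); [|apply Hgam1].
      apply (Cder_ccont h _ (h' (gam s t))). now apply Hh, Hg. }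
  assert (Z : forall s, - e < s < 1 + e -> cmean (dF s) = RtoC 0).
  { intros s Hs.
    (* As a function of [t], the integrand has the primitive [h (gam s t) / (s i)]. At [s = 0] this
       breaks down, but there the integrand is [h' w * zeta], with primitive [- i h' w * zeta]. *)
    destruct (Req_dec s 0) as [Es|Es].
    - subst s.
      apply (cmean_curve_der (fun t => h' w * (- Ci) * circ t)%C); [|now apply HdFc|].
      + intros t.
        apply (curve_der_ext (fun t => (fun y => RtoC 0 + (h' w * (- Ci)) * y)%C (circ t)) _ t
                 ((Ci * circ t) * (h' w * (- Ci)))%C).
        * intros r. ring.
        * unfold dF, gam. replace (w + RtoC 0 * (circ t - w))%C with w by ring.
          replace (Ci * circ t * (h' w * - Ci))%C with (- (Ci * Ci) * (h' w * circ t))%C by ring.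
          replace (- (Ci * Ci))%C with (RtoC 1); [ring|].
          unfold Ci, Copp, Cmult, RtoC; simpl. f_equal; ring.
        * apply (curve_der_comp (fun y => RtoC 0 + (h' w * (- Ci)) * y)%C circ);
            [apply Cder_affine | apply curve_der_circ].
      + now rewrite circ_2PI.
    - assert (Hs0 : RtoC s <> RtoC 0) by (intros E; apply Es; now apply RtoC_inj).
      apply (cmean_curve_der (fun t => h (gam s t) * / (RtoC s * Ci))%C); [|now apply HdFc|].
      + intros t.
        apply (curve_der_ext
                 (fun t => (fun y => h (w + RtoC s * (y - w)) * / (RtoC s * Ci))%C (circ t)) _ t
                 ((Ci * circ t) * ((RtoC s * h' (gam s t)) * / (RtoC s * Ci)))%C).
        * reflexivity.
        * unfold dF. field. split; [exact Ci_nz | exact Hs0].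
        * apply (curve_der_comp (fun y => h (w + RtoC s * (y - w)) * / (RtoC s * Ci))%C circ);
            [|apply curve_der_circ].
          apply (Cder_val _ _ ((RtoC s * h' (gam s t)) * / (RtoC s * Ci) +
                   h (w + RtoC s * (circ t - w)) * RtoC 0)%C); [ring|].
          apply (Cder_mult (fun y => h (w + RtoC s * (y - w)))%C (fun _ => / (RtoC s * Ci))%C);
            [|apply Cder_const].
          apply (Cder_comp h (fun y => w + RtoC s * (y - w))%C).
          -- now apply Hh, Hg.
          -- apply (is_derive_ext (K := C_AbsRing) (V := AbsRing_NormedModule C_AbsRing)
                      (fun y => (w - RtoC s * w) + RtoC s * y)%C).
             ++ intros y. change (w - RtoC s * w + RtoC s * y = w + RtoC s * (y - w))%C. ring.
             ++ apply Cder_affine.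
      + unfold gam. now rewrite circ_2PI. }
  assert (E : cmean (F 0) = cmean (F 1)).
  { apply (curve_der_0_eq (fun s => cmean (F s)) 0 1); [lra|]. intros s Hs.
    rewrite <- (Z s) by lra. apply D. lra. }
  (* The path [gam s t] runs from [w] at [s = 0] to [circ t] at [s = 1]. *)
  transitivity (cmean (F 1)); [|rewrite <- E]; apply cmean_ext; intros t; unfold F, gam, K;
    f_equal; f_equal; ring.
Qed.

(** At [w = 0] the kernel is [1]. This case comes before the general formula, which uses it to
    evaluate the mean of the kernel. *)
Lemma mean_value (R0 : R) (h : C -> C) : 1 < R0 -> holo R0 h ->
  cmean (fun t => h (circ t)) = h (RtoC 0).
Proof.
  intros HR Hh.
  assert (H0 : Cmod (RtoC 0) < 1) by (rewrite Cmod_0; lra).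
  pose proof (cauchy_formula_aux R0 h (RtoC 0) HR Hh H0) as E.
  rewrite (cmean_ext _ (fun t => h (circ t))) in E.
  - rewrite E. transitivity (cmean (fun _ => h (RtoC 0))); [|apply cmean_const].
    apply cmean_ext.
    intros t. field. apply circ_neq_0.
  - intros t. field. apply circ_neq_0.
Qed.

Lemma Cconj_circ_kernel (t : R) (w : C) : Cmod w < 1 ->
  (1 - Cconj w * circ t)%C <> RtoC 0.
Proof.
  intros Hw E. assert (E1 : (Cconj w * circ t)%C = RtoC 1).
  { replace (Cconj w * circ t)%C with (1 - (1 - Cconj w * circ t))%C by ring. rewrite E. ring. }
  assert (E2 : Cmod (Cconj w * circ t) = 1) by (rewrite E1; apply Cmod_1).
  rewrite Cmod_mult, Cmod_conj, Cmod_circ in E2. lra.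
Qed.

(** The radius [2 / (1 + |w|)] exceeds [1] yet does not pass the pole, because [2 |w| <= 1 + |w|];
    unlike [1 / |w|] it makes sense at [w = 0]. *)
Lemma one_minus_conj_mult_neq_0 (w z : C) : Cmod w < 1 -> Cmod z < 2 / (1 + Cmod w) ->
  (1 - Cconj w * z)%C <> RtoC 0.
Proof.
  intros Hw Hz E. assert (E1 : (Cconj w * z)%C = RtoC 1).
  { replace (Cconj w * z)%C with (1 - (1 - Cconj w * z))%C by ring. rewrite E. ring. }
  assert (E2 : Cmod (Cconj w * z) = 1) by (rewrite E1; apply Cmod_1).
  rewrite Cmod_mult, Cmod_conj in E2. pose proof (Cmod_ge_0 w).
  assert (2 / (1 + Cmod w) * (1 + Cmod w) = 2) by (field; lra). nra.
Qed.

Lemma two_div_gt_1 (x : R) : 0 <= x < 1 -> 1 < 2 / (1 + x).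
Proof.
  intros Hx. apply Rmult_lt_reg_r with (1 + x); [lra|].
  replace (2 / (1 + x) * (1 + x)) with 2 by (field; lra). lra.
Qed.

Lemma holo_conj_kernel (w : C) : Cmod w < 1 ->
  holo (2 / (1 + Cmod w)) (fun z => / (1 - Cconj w * z))%C.
Proof.
  intros Hw. apply holo_inv.
  - intros z Hz. now apply one_minus_conj_mult_neq_0.
  - apply (holo_plus _ (fun _ => RtoC 1) (fun z => - (Cconj w * z))%C); [apply holo_const|].
    destruct (holo_mult (2 / (1 + Cmod w)) (fun _ => - Cconj w)%C (fun z => z)
                (holo_const _ _) (holo_id _)) as [d Hd].
    exists d. intros z Hz. destruct (Hd z Hz) as [D1 D2]. split; [|exact D2].
    apply (is_derive_ext (K := C_AbsRing) (V := AbsRing_NormedModule C_AbsRing)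
             (fun y => - Cconj w * y)%C); [|exact D1].
    intros y. change (- Cconj w * y = - (Cconj w * y))%C. ring.
Qed.

(** On the circle [1 / zeta = conj zeta], so the Cauchy kernel is the conjugate of a function
    holomorphic beyond the closed disk, to which [mean_value] applies. *)
Lemma kernel_conj (t : R) (w : C) : Cmod w < 1 ->
  (circ t * / (circ t - w))%C = Cconj (/ (1 - Cconj w * circ t)).
Proof.
  intros Hw. rewrite Cinv_conj by now apply Cconj_circ_kernel.
  rewrite Cminus_conj, Cmult_conj, Cconj_conj.
  replace (Cconj (RtoC 1)) with (RtoC 1) by (unfold Cconj, RtoC; simpl; f_equal; ring).
  rewrite <- (circ_conj_mult t).
  replace (circ t * Cconj (circ t) - w * Cconj (circ t))%C
    with (Cconj (circ t) * (circ t - w))%C by ring.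
  assert (H1 : Cconj (circ t) <> RtoC 0)
    by (apply Cmod_gt_0; rewrite Cmod_conj, Cmod_circ; lra).
  pose proof (circ_minus_neq_0 t w Hw) as H2.
  replace (/ (Cconj (circ t) * (circ t - w)))%C
    with ((circ t * Cconj (circ t)) * / (Cconj (circ t) * (circ t - w)))%C
    by (rewrite circ_conj_mult; ring).
  field. auto.
Qed.

(** [cauchy_formula_aux] leaves [h w] times the mean of the kernel, and the conjugate of that mean
    is the value of [1 / (1 - conj w z)] at [0]. *)
Theorem cauchy_formula (R0 : R) (h : C -> C) (w : C) :
  1 < R0 -> holo R0 h -> Cmod w < 1 ->
  cmean (fun t => h (circ t) * (circ t * / (circ t - w)))%C = h w.
Proof.
  intros HR Hh Hw. rewrite (cauchy_formula_aux R0) by assumption.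
  pose proof (Cmod_ge_0 w).
  assert (HR' : 1 < 2 / (1 + Cmod w)) by (apply two_div_gt_1; lra).
  assert (Hc : ccts (fun t => / (1 - Cconj w * circ t))%C)
    by (apply (ccts_holo _ _ HR' (holo_conj_kernel w Hw))).
  rewrite (cmean_ext _ (fun t => h w * Cconj (/ (1 - Cconj w * circ t)))%C)
    by (intros t; now rewrite kernel_conj).
  rewrite cmean_scal, cmean_conj by auto using ccts_conj.
  rewrite (mean_value _ _ HR' (holo_conj_kernel w Hw)).
  replace (1 - Cconj w * 0)%C with (RtoC 1) by ring.
  replace (Cconj (/ RtoC 1)) with (RtoC 1); [ring|].
  unfold Cconj, Cinv, RtoC; simpl. f_equal; field.
Qed.

(** * Complex power series *)

Local Notation Cis_series a l := (is_series (K := C_AbsRing) (V := C_NormedModule) a l).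

(** A total function, by way of the real [Series], so that terms can be rewritten without a
    convergence proof at hand. *)
Definition CSeries (a : nat -> C) : C :=
  (Series (fun n => Re (a n)), Series (fun n => Im (a n))).

Lemma CSeries_ext (a b : nat -> C) : (forall n, a n = b n) -> CSeries a = CSeries b.
Proof. intros H. unfold CSeries. f_equal; apply Series_ext; intros n; now rewrite H. Qed.

Lemma Re_sum_n (a : nat -> C) (n : nat) :
  Re (sum_n (G := C_AbelianMonoid) a n) = sum_n (fun k => Re (a k)) n.
Proof.
  induction n as [|n IH]; [now rewrite !sum_O|].
  rewrite !sum_Sn, <- IH. reflexivity.
Qed.

Lemma Im_sum_n (a : nat -> C) (n : nat) :
  Im (sum_n (G := C_AbelianMonoid) a n) = sum_n (fun k => Im (a k)) n.
Proof.
  induction n as [|n IH]; [now rewrite !sum_O|].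
  rewrite !sum_Sn, <- IH. reflexivity.
Qed.

Lemma Cis_series_unique (a : nat -> C) (l : C) : Cis_series a l -> CSeries a = l.
Proof.
  intros H. rewrite (surjective_pairing l). unfold CSeries. f_equal; apply is_series_unique.
  - apply (filterlim_ext (fun n => Re (sum_n (G := C_AbelianMonoid) a n)));
      [apply Re_sum_n|].
    apply (filterlim_comp _ _ _ _ _ _ (locally (T := C_UniformSpace) l) _ H).
    intros P [e He]. exists e. intros y [Hy _]. apply He, Hy.
  - apply (filterlim_ext (fun n => Im (sum_n (G := C_AbelianMonoid) a n)));
      [apply Im_sum_n|].
    apply (filterlim_comp _ _ _ _ _ _ (locally (T := C_UniformSpace) l) _ H).
    intros P [e He]. exists e. intros y [_ Hy]. apply He, Hy.
Qed.

Lemma CSeries_correct (a : nat -> C) : ex_series (fun n => Cmod (a n)) -> Cis_series a (CSeries a).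
Proof.
  intros H.
  destruct (ex_series_le (K := C_AbsRing) (V := C_CompleteNormedModule) a
              (fun n => Cmod (a n)) (fun n => Rle_refl _) H) as [l Hl].
  now rewrite (Cis_series_unique a l Hl).
Qed.

Lemma Cmod_CSeries_le (a : nat -> C) (b : nat -> R) :
  (forall n, Cmod (a n) <= b n) -> ex_series b -> Cmod (CSeries a) <= Series b.
Proof.
  intros Hab Hb.
  assert (Ha : ex_series (fun n => Cmod (a n))).
  { apply (ex_series_le (K := R_AbsRing) (V := R_CompleteNormedModule) _ b); [|exact Hb].
    intros n. change (Rabs (Cmod (a n)) <= b n). rewrite Rabs_pos_eq; [apply Hab|apply Cmod_ge_0]. }
  pose proof (CSeries_correct a Ha) as HS.
  assert (HN : is_lim_seq (fun n => Cmod (sum_n (G := C_AbelianMonoid) a n)) (Cmod (CSeries a))).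
  { apply (filterlim_comp _ _ _ _ _ _ (locally (T := C_UniformSpace) (CSeries a)) _ HS).
    apply (filterlim_norm (K := C_AbsRing) (V := C_NormedModule)). }
  pose proof (Series_correct b Hb) as HB.
  refine (is_lim_seq_le _ _ (Finite (Cmod (CSeries a))) (Finite (Series b)) _ HN HB).
  intros n. induction n as [|n IH]; [rewrite !sum_O; apply Hab|].
  rewrite !sum_Sn. eapply Rle_trans; [apply Cmod_triangle|].
  apply Rplus_le_compat; [exact IH | apply Hab].
Qed.

Definition CPSeries (a : nat -> C) (z : C) : C := CSeries (fun n => a n * z ^ n)%C.

(** A radius of convergence of at least [R0], in the form that comparison tests use. *)
Definition abs_conv (R0 : R) (a : nat -> C) : Prop :=
  forall r, 0 <= r < R0 -> ex_series (fun n => Cmod (a n) * r ^ n).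

Lemma ex_series_Rle (a b : nat -> R) :
  (forall n, 0 <= a n <= b n) -> ex_series b -> ex_series a.
Proof.
  intros H. apply (ex_series_le (K := R_AbsRing) (V := R_CompleteNormedModule)).
  intros n. change (Rabs (a n) <= b n). rewrite Rabs_pos_eq; apply H.
Qed.

Lemma abs_conv_le (R0 : R) (a b : nat -> C) :
  (forall n, Cmod (a n) <= Cmod (b n)) -> abs_conv R0 b -> abs_conv R0 a.
Proof.
  intros H Hb r Hr. apply ex_series_Rle with (2 := Hb r Hr). intros n.
  assert (0 <= r ^ n) by (apply pow_le; lra).
  split; [apply Rmult_le_pos; auto using Cmod_ge_0 | apply Rmult_le_compat_r; auto].
Qed.

Lemma CPSeries_is_series (R0 : R) (a : nat -> C) (z : C) : abs_conv R0 a -> Cmod z < R0 ->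
  Cis_series (fun n => a n * z ^ n)%C (CPSeries a z).
Proof.
  intros Ha Hz. apply CSeries_correct.
  eapply ex_series_ext; [|apply (Ha (Cmod z)); split; [apply Cmod_ge_0 | exact Hz]].
  intros n. simpl. now rewrite Cmod_mult, Cmod_pow.
Qed.

Lemma CPSeries_unique (a : nat -> C) (z l : C) : Cis_series (fun n => a n * z ^ n)%C l -> CPSeries a z = l.
Proof. apply Cis_series_unique. Qed.

Lemma CPSeries_ext (a b : nat -> C) (z : C) : (forall n, a n = b n) -> CPSeries a z = CPSeries b z.
Proof.
  intros H. apply CSeries_ext. intros n. now rewrite H.
Qed.

Lemma abs_conv_plus (R0 : R) (a b : nat -> C) : abs_conv R0 a -> abs_conv R0 b ->
  abs_conv R0 (fun n => a n + b n)%C.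
Proof.
  intros Ha Hb r Hr.
  apply ex_series_Rle with (fun n => Cmod (a n) * r ^ n + Cmod (b n) * r ^ n).
  - intros n. assert (0 <= r ^ n) by (apply pow_le; lra).
    pose proof (Cmod_triangle (a n) (b n)). pose proof (Cmod_ge_0 (a n + b n)).
    split; nra.
  - apply (ex_series_plus (K := R_AbsRing) (V := R_NormedModule)
             (fun n => Cmod (a n) * r ^ n) (fun n => Cmod (b n) * r ^ n)); auto.
Qed.

Lemma CPSeries_plus (R0 : R) (a b : nat -> C) (z : C) : abs_conv R0 a -> abs_conv R0 b -> Cmod z < R0 ->
  CPSeries (fun n => a n + b n)%C z = (CPSeries a z + CPSeries b z)%C.
Proof.
  intros Ha Hb Hz. apply CPSeries_unique.
  eapply is_series_ext;
    [|apply (is_series_plus (K := C_AbsRing) (V := C_NormedModule) _ _ _ _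
               (CPSeries_is_series R0 a z Ha Hz) (CPSeries_is_series R0 b z Hb Hz))].
  intros n. change (a n * z ^ n + b n * z ^ n = (a n + b n) * z ^ n)%C. ring.
Qed.

Lemma abs_conv_scal (R0 : R) (c : C) (a : nat -> C) : abs_conv R0 a -> abs_conv R0 (fun n => c * a n)%C.
Proof.
  intros Ha r Hr.
  apply ex_series_ext with (fun n => scal (Cmod c) (Cmod (a n) * r ^ n)).
  - intros n. rewrite Cmod_mult. unfold scal; simpl; unfold mult; simpl. ring.
  - now apply (ex_series_scal (K := R_AbsRing) (V := R_NormedModule)), Ha.
Qed.

Lemma CPSeries_scal (R0 : R) (c : C) (a : nat -> C) (z : C) : abs_conv R0 a -> Cmod z < R0 ->
  CPSeries (fun n => c * a n)%C z = (c * CPSeries a z)%C.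
Proof.
  intros Ha Hz. apply CPSeries_unique.
  eapply is_series_ext;
    [|apply (is_series_scal (K := C_AbsRing) (V := C_NormedModule) c _ _
               (CPSeries_is_series R0 a z Ha Hz))].
  intros n. change (c * (a n * z ^ n) = c * a n * z ^ n)%C. ring.
Qed.

Lemma abs_conv_shift (R0 : R) (a : nat -> C) : abs_conv R0 a -> abs_conv R0 (fun n => a (S n)).
Proof.
  intros Ha r Hr.
  (* An intermediate radius is positive even for [r = 0], so one may divide by it. *)
  assert (Hm : 0 <= (r + R0) / 2 < R0) by lra.
  set (q := (r + R0) / 2) in *. assert (Hq : 0 < q) by (unfold q; lra).
  pose proof (proj1 (ex_series_incr_1 _) (Ha q Hm)) as H.
  apply ex_series_Rle with (fun n => scal (/ q) (Cmod (a (S n)) * q ^ (S n))).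
  - intros n. split; [apply Rmult_le_pos; [apply Cmod_ge_0|apply pow_le; lra]|].
    unfold scal; simpl; unfold mult; simpl.
    replace (/ q * (Cmod (a (S n)) * (q * q ^ n))) with (Cmod (a (S n)) * q ^ n) by (field; lra).
    apply Rmult_le_compat_l; [apply Cmod_ge_0|]. apply pow_incr. unfold q. lra.
  - now apply (ex_series_scal (K := R_AbsRing) (V := R_NormedModule)).
Qed.

Lemma CPSeries_shift (R0 : R) (a : nat -> C) (z : C) : abs_conv R0 a -> Cmod z < R0 ->
  CPSeries a z = (a 0%nat + z * CPSeries (fun n => a (S n)) z)%C.
Proof.
  intros Ha Hz.
  pose proof (is_series_scal (K := C_AbsRing) (V := C_NormedModule) z _ _
               (CPSeries_is_series R0 _ z (abs_conv_shift R0 a Ha) Hz)) as H.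
  apply CPSeries_unique.
  apply (is_series_decr_1 (K := C_AbsRing) (V := C_NormedModule)).
  eapply is_series_ext; [|replace (plus _ _) with (scal z (CPSeries (fun n => a (S n)) z)); [exact H|]].
  - intros n. change (z * (a (S n) * z ^ n) = a (S n) * z ^ (S n))%C. rewrite Cpow_S. ring.
  - change (z * CPSeries (fun n => a (S n)) z =
      (a 0%nat + z * CPSeries (fun n => a (S n)) z) + - (a 0%nat * z ^ 0))%C.
    simpl. ring.
Qed.

Lemma CPSeries_0 (R0 : R) (a : nat -> C) : 0 < R0 -> abs_conv R0 a -> CPSeries a (RtoC 0) = a 0%nat.
Proof. intros HR Ha. rewrite (CPSeries_shift R0) by (rewrite ?Cmod_0; auto). ring. Qed.

Definition derive_coef (a : nat -> C) (n : nat) : C := (RtoC (INR (S n)) * a (S n))%C.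

(** [q^(n+1) - r^(n+1)] is [q - r] times a sum of [n + 1] products, each at least [r^n]. This trades
    the factor [n + 1] of a derivative for a slightly larger radius. *)
Lemma S_mult_pow_le (r q : R) (n : nat) : 0 <= r <= q ->
  INR (S n) * r ^ n * (q - r) <= q ^ (S n).
Proof.
  intros H. induction n as [|n IH]; [simpl; lra|].
  assert (Hrq : r ^ (S n) <= q ^ (S n)) by (apply pow_incr; lra).
  replace (INR (S (S n)) * r ^ (S n) * (q - r))
    with (r * (INR (S n) * r ^ n * (q - r)) + r ^ (S n) * (q - r))
    by (rewrite (S_INR (S n)); simpl pow; ring).
  replace (q ^ (S (S n))) with (r * q ^ (S n) + q ^ (S n) * (q - r)) by (simpl; ring).
  apply Rplus_le_compat; [apply Rmult_le_compat_l; lra | apply Rmult_le_compat_r; lra].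
Qed.

Lemma abs_conv_derive_coef (R0 : R) (a : nat -> C) : abs_conv R0 a -> abs_conv R0 (derive_coef a).
Proof.
  intros Ha r Hr.
  assert (Hm : 0 <= (r + R0) / 2 < R0) by lra.
  set (q := (r + R0) / 2) in *. assert (Hq : r < q) by (unfold q; lra).
  pose proof (proj1 (ex_series_incr_1 _) (Ha q Hm)) as H.
  apply ex_series_Rle with (fun n => scal (/ (q - r)) (Cmod (a (S n)) * q ^ (S n))).
  - intros n. split; [apply Rmult_le_pos; [apply Cmod_ge_0|apply pow_le; lra]|].
    unfold scal; cbn -[pow INR]; unfold mult; cbn -[pow INR].
    unfold derive_coef. rewrite Cmod_mult, Cmod_R, Rabs_pos_eq by apply pos_INR.
    apply Rmult_le_reg_r with (q - r); [lra|].
    replace (/ (q - r) * (Cmod (a (S n)) * q ^ S n) * (q - r))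
      with (Cmod (a (S n)) * q ^ S n) by (field; lra).
    replace (INR (S n) * Cmod (a (S n)) * r ^ n * (q - r))
      with (Cmod (a (S n)) * (INR (S n) * r ^ n * (q - r))) by ring.
    apply Rmult_le_compat_l; [apply Cmod_ge_0|]. apply S_mult_pow_le. lra.
  - now apply (ex_series_scal (K := R_AbsRing) (V := R_NormedModule)).
Qed.

(** The constant is twice the sharp one: it is the factor that two applications of [derive_coef]
    produce. *)
Lemma pow_remainder (y z : C) (rho : R) (n : nat) : Cmod y <= rho -> Cmod z <= rho ->
  Cmod (y ^ (S (S n)) - z ^ (S (S n)) - RtoC (INR (S (S n))) * z ^ (S n) * (y - z)) <=
  INR (S (S n)) * INR (S n) * rho ^ n * Cmod (y - z) ^ 2.
Proof.
  intros Hy Hz. pose proof (Cmod_ge_0 y). pose proof (Cmod_ge_0 z).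
  assert (Hrho : 0 <= rho) by lra.
  induction n as [|n IH].
  - replace (y ^ 2 - z ^ 2 - RtoC (INR 2) * z ^ 1 * (y - z))%C with ((y - z) * (y - z))%C.
    + rewrite Cmod_mult. simpl. pose proof (Cmod_ge_0 (y - z)). nra.
    + replace (INR 2) with (1 + 1) by (simpl; ring). rewrite RtoC_plus. simpl. ring.
  - set (m := S (S n)) in *.
    replace (y ^ S m - z ^ S m - RtoC (INR (S m)) * z ^ m * (y - z))%C
      with (y * (y ^ m - z ^ m - RtoC (INR m) * z ^ (S n) * (y - z)) +
            RtoC (INR m) * z ^ (S n) * ((y - z) * (y - z)))%C.
    + eapply Rle_trans; [apply Cmod_triangle|].
      rewrite !Cmod_mult, Cmod_R, Cmod_pow, Rabs_pos_eq by apply pos_INR.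
      set (d := Cmod (y - z)) in *. 
      set (E := Cmod (y ^ m - z ^ m - RtoC (INR m) * z ^ S n * (y - z))) in *.
      assert (E0 : 0 <= E) by apply Cmod_ge_0.
      assert (X1 : Cmod y * E <= rho * (INR m * INR (S n) * rho ^ n * d ^ 2))
        by (apply Rmult_le_compat; lra).
      assert (X2 : Cmod z ^ S n <= rho ^ S n) by (apply pow_incr; lra).
      assert (X3 : INR m * Cmod z ^ S n * (d * d) <= INR m * rho ^ S n * (d * d)).
      { apply Rmult_le_compat_r; [nra|]. apply Rmult_le_compat_l; [apply pos_INR | exact X2]. }
      assert (X4 : 0 <= INR m * rho ^ S n * d ^ 2).
      { apply Rmult_le_pos; [|nra]. apply Rmult_le_pos; [apply pos_INR|now apply pow_le]. }
      rewrite (S_INR m).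
      replace ((INR m + 1) * INR m * rho ^ S n * d ^ 2)
        with (rho * (INR m * INR (S n) * rho ^ n * d ^ 2) + INR m * rho ^ S n * (d * d) +
              INR m * rho ^ S n * d ^ 2); [lra|].
      unfold m. rewrite (S_INR (S n)). simpl pow. ring.
    + unfold m. rewrite (S_INR (S (S n))), RtoC_plus.
      rewrite !Cpow_S. ring.
Qed.

(** The terms of index [0] and [1] cancel in the error, which becomes a series of power remainders.
    It is at most [K |y - z|^2], where [K] is the second derivative of the series of moduli at a
    radius [rho] between [|z|] and [R0]. *)
Lemma CPSeries_derive (R0 : R) (a : nat -> C) (z : C) : abs_conv R0 a -> Cmod z < R0 ->
  Cder (CPSeries a) z (CPSeries (derive_coef a) z).
Proof.
  intros Ha Hz. pose proof (Cmod_ge_0 z) as Hz0.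
  set (rho := (Cmod z + R0) / 2).
  assert (Hrho : 0 <= rho < R0) by (unfold rho; lra).
  set (b := fun n => Cmod (derive_coef (derive_coef a) n) * rho ^ n).
  assert (Hb : ex_series b)
    by (apply (abs_conv_derive_coef R0 (derive_coef a)); [now apply abs_conv_derive_coef | exact Hrho]).
  set (K := Series b).
  assert (Bnd : forall y, Cmod y <= rho ->
    Cmod (CPSeries a y - CPSeries a z - (y - z) * CPSeries (derive_coef a) z) <= K * Cmod (y - z) ^ 2).
  { intros y Hy.
    set (a2 := fun n => a (S (S n))).
    assert (Hya : Cmod y < R0) by lra.
    pose proof (abs_conv_shift R0 a Ha) as Ha1.
    pose proof (abs_conv_shift R0 _ Ha1) as Ha2.
    pose proof (abs_conv_derive_coef R0 a Ha) as Hd.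
    pose proof (abs_conv_shift R0 _ Hd) as Hd1.
    set (E := fun n => (a2 n * (y ^ (S (S n)) - z ^ (S (S n)) -
                 RtoC (INR (S (S n))) * z ^ (S n) * (y - z)))%C).
    assert (HE : Cis_series E (CPSeries a y - CPSeries a z - (y - z) * CPSeries (derive_coef a) z)%C).
    { pose proof (is_series_scal (K := C_AbsRing) (V := C_NormedModule) (y * y)%C _ _
                    (CPSeries_is_series R0 a2 y Ha2 Hya)) as S1.
      pose proof (is_series_scal (K := C_AbsRing) (V := C_NormedModule) (- (z * z))%C _ _
                    (CPSeries_is_series R0 a2 z Ha2 Hz)) as S2.
      pose proof (is_series_scal (K := C_AbsRing) (V := C_NormedModule) (- ((y - z) * z))%C _ _
                    (CPSeries_is_series R0 _ z Hd1 Hz)) as S3.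
      pose proof (is_series_plus (K := C_AbsRing) (V := C_NormedModule) _ _ _ _ S1
                    (is_series_plus (K := C_AbsRing) (V := C_NormedModule) _ _ _ _ S2 S3)) as S4.
      rewrite (CPSeries_shift R0 a y), (CPSeries_shift R0 a z), (CPSeries_shift R0 (derive_coef a) z) by assumption.
      rewrite (CPSeries_shift R0 _ y Ha1), (CPSeries_shift R0 _ z Ha1) by assumption. fold a2.
      match type of S4 with is_series _ ?l => replace (_ - _ - _)%C with l end.
      - eapply is_series_ext; [|exact S4]. intros n. unfold E, derive_coef, a2.
        change (y * y * (a (S (S n)) * y ^ n) + (- (z * z) * (a (S (S n)) * z ^ n) +
          - ((y - z) * z) * (RtoC (INR (S (S n))) * a (S (S n)) * z ^ n)) =
          a (S (S n)) * (y ^ S (S n) - z ^ S (S n) -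
            RtoC (INR (S (S n))) * z ^ S n * (y - z)))%C.
        rewrite !Cpow_S. ring.
      - change (y * y * CPSeries a2 y + (- (z * z) * CPSeries a2 z +
          - ((y - z) * z) * CPSeries (fun n => derive_coef a (S n)) z) =
          a 0%nat + y * (a 1%nat + y * CPSeries a2 y) - (a 0%nat + z * (a 1%nat + z * CPSeries a2 z)) -
          (y - z) * (derive_coef a 0 + z * CPSeries (fun n => derive_coef a (S n)) z))%C.
        unfold derive_coef at 2. simpl INR. ring. }
    rewrite <- (Cis_series_unique _ _ HE).
    replace (K * Cmod (y - z) ^ 2) with (Cmod (y - z) ^ 2 * K) by ring.
    unfold K. rewrite <- (Series_scal_l (Cmod (y - z) ^ 2) b).
    apply Cmod_CSeries_le.
    - intros n. unfold E, a2. rewrite Cmod_mult.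
      eapply Rle_trans; [apply Rmult_le_compat_l; [apply Cmod_ge_0|];
        apply (pow_remainder y z rho n); [exact Hy | unfold rho; lra]|].
      right. unfold b, derive_coef. rewrite !Cmod_mult, !Cmod_R, !Rabs_pos_eq by apply pos_INR. ring.
    - apply (ex_series_scal_l (Cmod (y - z) ^ 2) b Hb). }
  (* Read off from the bound at [y = rho], a point different from [z]. *)
  assert (HK : 0 <= K).
  { assert (Hy1 : Cmod (RtoC rho) <= rho) by (rewrite Cmod_R, Rabs_pos_eq; lra).
    pose proof (Bnd _ Hy1) as B.
    assert (0 < Cmod (RtoC rho - z)).
    { pose proof (Cmod_triangle (RtoC rho - z) z) as T.
      replace (RtoC rho - z + z)%C with (RtoC rho) in T by ring.
      rewrite (Cmod_R rho), (Rabs_pos_eq rho) in T by lra. unfold rho in *. lra. }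
    match type of B with Cmod ?X <= _ => pose proof (Cmod_ge_0 X) end.
    assert (0 < Cmod (RtoC rho - z) ^ 2) by nra.
    apply Rnot_lt_le. intros HKn. nra. }
  apply Cder_eps. intros eps. pose proof (cond_pos eps) as Pe.
  assert (Hd : 0 < Rmin (rho - Cmod z) (eps / (K + 1))).
  { apply Rmin_glb_lt; [unfold rho; lra|]. apply Rdiv_lt_0_compat; lra. }
  exists (mkposreal _ Hd). intros y Hy. cbn [pos] in Hy.
  pose proof (Rmin_l (rho - Cmod z) (eps / (K + 1))).
  pose proof (Rmin_r (rho - Cmod z) (eps / (K + 1))).
  assert (Hyr : Cmod y <= rho).
  { pose proof (Cmod_triangle (y - z) z) as T.
    replace (y - z + z)%C with y in T by ring. lra. }
  eapply Rle_trans; [apply (Bnd y Hyr)|].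
  pose proof (Cmod_ge_0 (y - z)) as Hd0. set (d := Cmod (y - z)) in *.
  assert (eps / (K + 1) * (K + 1) = eps) by (field; lra).
  assert (K * d <= eps) by nra. nra.
Qed.

Lemma holo_CPSeries (R0 : R) (a : nat -> C) : abs_conv R0 a -> holo R0 (CPSeries a).
Proof.
  intros Ha. exists (CPSeries (derive_coef a)). intros z Hz. split; [now apply (CPSeries_derive R0)|].
  apply (Cder_ccont _ _ (CPSeries (derive_coef (derive_coef a)) z)).
  apply (CPSeries_derive R0); [now apply abs_conv_derive_coef | exact Hz].
Qed.

(** The operator [z d/dz] on coefficients. Unlike [derive_coef] it keeps the index, hence commutes
    with truncation and dilation. *)
Definition euler_coef (a : nat -> C) (n : nat) : C := (RtoC (INR n) * a n)%C.

Lemma abs_conv_euler_coef (R0 : R) (a : nat -> C) : abs_conv R0 a -> abs_conv R0 (euler_coef a).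
Proof.
  intros Ha r Hr. apply ex_series_incr_1.
  apply ex_series_ext with (fun n => scal r (Cmod (derive_coef a n) * r ^ n)).
  - intros n. unfold scal; simpl; unfold mult; simpl. unfold derive_coef, euler_coef. ring.
  - apply (ex_series_scal (K := R_AbsRing) (V := R_NormedModule)).
    now apply (abs_conv_derive_coef R0 a Ha).
Qed.

Lemma CPSeries_euler_coef (R0 : R) (a : nat -> C) (z : C) : abs_conv R0 a -> Cmod z < R0 ->
  CPSeries (euler_coef a) z = (z * CPSeries (derive_coef a) z)%C.
Proof.
  intros Ha Hz. rewrite (CPSeries_shift R0) by (auto using abs_conv_euler_coef).
  unfold euler_coef at 1. simpl INR. rewrite (CPSeries_ext _ (derive_coef a)) by reflexivity. ring.
Qed.

(** Abel's argument: at a larger radius [q] the terms are eventually below [1], and [(r / q)^n] then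
    dominates. *)
Lemma abs_conv_of_real_points (R0 : R) (a : nat -> C) :
  (forall r, 0 < r < R0 ->
     ex_series (K := C_AbsRing) (V := C_NormedModule) (fun n => a n * RtoC r ^ n)%C) ->
  abs_conv R0 a.
Proof.
  intros H r Hr. set (q := (r + R0) / 2). assert (Hq : r < q < R0) by (unfold q; lra).
  assert (Hq0 : 0 < q < R0) by lra.
  destruct (Cauchy_ex_series (K := C_AbsRing) (V := C_CompleteNormedModule) _ (H q Hq0)
              (mkposreal 1 Rlt_0_1)) as [N HN].
  apply (ex_series_incr_n _ N).
  apply ex_series_Rle with (fun n => (r / q) ^ n).
  - intros n.
    assert (Hle : (N <= N + n)%nat) by lia.
    specialize (HN (N + n)%nat (N + n)%nat Hle Hle). rewrite sum_n_n in HN.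
    set (m := (N + n)%nat) in *.
    change (Cmod (a m * RtoC q ^ m) < 1) in HN.
    rewrite Cmod_mult, Cmod_pow, Cmod_R, Rabs_pos_eq in HN by lra.
    pose proof (Cmod_ge_0 (a m)).
    split; [apply Rmult_le_pos; [assumption|apply pow_le; lra]|].
    assert (Hrq : 0 <= r / q <= 1).
    { split; [apply Rdiv_le_0_compat; lra|]. apply Rmult_le_reg_r with q; [lra|].
      replace (r / q * q) with r by (field; lra). lra. }
    replace (r ^ m) with (q ^ m * (r / q) ^ m)
      by (rewrite <- Rpow_mult_distr; f_equal; field; lra).
    rewrite <- Rmult_assoc.
    apply Rle_trans with (1 * (r / q) ^ m).
    + apply Rmult_le_compat_r; [apply pow_le; lra | lra].
    + unfold m. rewrite pow_add.
      assert ((r / q) ^ N <= 1) by (rewrite <- (pow1 N); apply pow_incr; lra).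
      assert (0 <= (r / q) ^ n) by (apply pow_le; lra). nra.
  - apply ex_series_geom. rewrite Rabs_pos_eq by (apply Rdiv_le_0_compat; lra).
    apply Rmult_lt_reg_r with q; [lra|].
    replace (r / q * q) with r by (field; lra). lra.
Qed.

Lemma Cmod_CPSeries_geom (a : nat -> C) (z : C) (A q : R) : 0 <= q < 1 ->
  (forall n, Cmod (a n) * Cmod z ^ n <= A * q ^ n) -> Cmod (CPSeries a z) <= A / (1 - q).
Proof.
  intros Hq H.
  assert (Hg : Rabs q < 1) by (rewrite Rabs_pos_eq; lra).
  replace (A / (1 - q)) with (Series (fun n => A * q ^ n))
    by (rewrite Series_scal_l, Series_geom by exact Hg; reflexivity).
  apply Cmod_CSeries_le.
  - intros n. rewrite Cmod_mult, Cmod_pow. apply H.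
  - apply (ex_series_scal_l A (fun n => q ^ n)), ex_series_geom, Hg.
Qed.

(** * Functions with positive real part *)

Lemma holo_le (R1 R2 : R) (h : C -> C) : R1 <= R2 -> holo R2 h -> holo R1 h.
Proof. intros HR [h' H]. exists h'. intros z Hz. apply H. lra. Qed.

Lemma Cconj_RtoC (x : R) : Cconj (RtoC x) = RtoC x.
Proof. unfold Cconj, RtoC; simpl. f_equal. ring. Qed.

Lemma plus_Cconj (z : C) : (z + Cconj z)%C = (RtoC (Re z) * RtoC 2)%C.
Proof. destruct z as [a b]. unfold Cconj, Cplus, Cmult, RtoC; simpl. f_equal; ring. Qed.

(** [v -> 1 / (1 - v)] maps the disk [|v| <= x] onto the disk with diameter from [1 / (1 + x)] to
    [1 / (1 - x)]. With denominators cleared, the claim reduces to [(1 - x) (x + Re v) >= 0]. *)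
Lemma Re_inv_one_minus (v : C) (x : R) : Cmod v <= x -> x < 1 ->
  / (1 + x) <= Re (/ (1 - v)).
Proof.
  intros Hv Hx. pose proof (Cmod_ge_0 v).
  assert (H2 : Re v ^ 2 + Im v ^ 2 <= x ^ 2)
    by (rewrite <- Cmod2_alt; apply pow_incr; lra).
  pose proof (re_le_Cmod v) as Ha. apply Rabs_le_between in Ha.
  destruct v as [a b]. simpl in Ha, H2. unfold Cinv, Cminus, Cplus, Copp, RtoC; simpl.
  assert (D : 0 < (1 + - a) * ((1 + - a) * 1) + (0 + - b) * ((0 + - b) * 1)) by nra.
  apply Rmult_le_reg_r with (1 + x); [lra|]. rewrite Rinv_l by lra.
  apply Rmult_le_reg_r with ((1 + - a) * ((1 + - a) * 1) + (0 + - b) * ((0 + - b) * 1)); [exact D|].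
  replace ((1 + - a) / ((1 + - a) * ((1 + - a) * 1) + (0 + - b) * ((0 + - b) * 1)) * (1 + x) *
    ((1 + - a) * ((1 + - a) * 1) + (0 + - b) * ((0 + - b) * 1)))
    with ((1 - a) * (1 + x)) by (field; lra).
  nra.
Qed.

Section PositiveRealPart.
Variables (R0 : R) (P : C -> C).
Hypotheses (HR : 1 < R0) (HP : holo R0 P) (HP0 : P (RtoC 0) = RtoC 1)
  (Hpos : forall z, Cmod z < R0 -> 0 < Re (P z)).

Local Definition bdry_re (t : R) : R := Re (P (circ t)).

Lemma bdry_re_ccts : ccts (fun t => P (circ t)).
Proof. now apply (ccts_holo R0). Qed.

Lemma bdry_re_rcts : rcts bdry_re.
Proof. exact (ccts_Re _ bdry_re_ccts). Qed.

Lemma bdry_re_pos (t : R) : 0 <= bdry_re t.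
Proof. left. apply Hpos. rewrite Cmod_circ. exact HR. Qed.

(** With positivity, this makes [bdry_re] a probability density on the circle, the Herglotz measure
    of [P]. *)
Lemma rmean_bdry_re : rmean bdry_re = 1.
Proof.
  pose proof (mean_value R0 P HR HP) as E. rewrite HP0 in E.
  exact (f_equal Re E).
Qed.

Lemma ccts_kernel (w : C) : Cmod w < 1 -> ccts (fun t => circ t * / (circ t - w))%C.
Proof.
  intros Hw t. apply ccont_mult; [apply ccont_circ|].
  apply (ccont_inv (fun t => circ t - w)%C); [now apply circ_minus_neq_0|].
  apply ccont_plus; [apply ccont_circ | apply ccont_const].
Qed.

(* Cauchy's formula for [P], plus the conjugate of the mean value property of
   [P z / (1 - conj w z)]. *)
Lemma herglotz (w : C) : Cmod w < 1 ->
  P w = (cmean (fun t => RtoC (bdry_re t) * (RtoC 2 * (circ t * / (circ t - w)))) - 1)%C.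
Proof.
  intros Hw. pose proof (Cmod_ge_0 w) as Hw0.
  pose proof (ccts_kernel w Hw) as HK. pose proof bdry_re_ccts as HB.
  assert (HR' : 1 < 2 / (1 + Cmod w)) by (apply two_div_gt_1; lra).
  set (R1 := Rmin R0 (2 / (1 + Cmod w))).
  assert (HR1 : 1 < R1) by (apply Rmin_glb_lt; assumption).
  assert (Hh : holo R1 (fun z => P z * / (1 - Cconj w * z))%C).
  { apply holo_mult.
    - apply holo_le with R0; [apply Rmin_l | exact HP].
    - apply holo_le with (2 / (1 + Cmod w)); [apply Rmin_r | now apply holo_conj_kernel]. }
  pose proof (mean_value R1 _ HR1 Hh) as E2.
  pose proof (cauchy_formula R0 P w HR HP Hw) as E1.
  apply (f_equal Cconj) in E2. rewrite <- cmean_conj in E2.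
  2: { apply (ccts_holo R1 _ HR1 Hh). }
  rewrite HP0 in E2.
  replace (Cconj (1 * / (1 - Cconj w * 0))%C) with (RtoC 1) in E2.
  2: { replace (1 * / (1 - Cconj w * 0))%C with (RtoC 1); [now rewrite Cconj_RtoC|].
       replace (1 - Cconj w * 0)%C with (RtoC 1) by ring. field. }
  rewrite (cmean_ext _ (fun t => Cconj (P (circ t)) * (circ t * / (circ t - w)))%C) in E2.
  2: { intros t. rewrite Cmult_conj, kernel_conj by exact Hw. reflexivity. }
  rewrite (cmean_ext _ (fun t => P (circ t) * (circ t * / (circ t - w)) +
    Cconj (P (circ t)) * (circ t * / (circ t - w)))%C).
  - rewrite cmean_plus, E1, E2 by auto using ccts_mult, ccts_conj. ring.
  - intros t. unfold bdry_re.
    replace (P (circ t) * (circ t * / (circ t - w)) +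
      Cconj (P (circ t)) * (circ t * / (circ t - w)))%C
      with ((P (circ t) + Cconj (P (circ t))) * (circ t * / (circ t - w)))%C by ring.
    rewrite plus_Cconj. ring.
Qed.

(** The real part of the Herglotz kernel is bounded below pointwise, and averaging against a
    probability density preserves the bound. *)
Lemma harnack_lower (w : C) : Cmod w < 1 -> 2 / (1 + Cmod w) - 1 <= Re (P w).
Proof.
  intros Hw. pose proof (Cmod_ge_0 w). rewrite (herglotz w Hw).
  unfold Cminus. rewrite re_plus, re_opp, re_RtoC.
  apply Rplus_le_compat_r.
  change (2 / (1 + Cmod w) <=
    rmean (fun t => Re (RtoC (bdry_re t) * (RtoC 2 * (circ t * / (circ t - w)))))).
  replace (2 / (1 + Cmod w)) with (rmean (fun t => 2 / (1 + Cmod w) * bdry_re t))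
    by (rewrite rmean_scal, rmean_bdry_re by apply bdry_re_rcts; ring).
  apply rmean_le.
  - apply rcts_scal, bdry_re_rcts.
  - apply ccts_Re, ccts_mult; [apply ccts_RtoC, bdry_re_rcts|].
    apply ccts_mult; [apply ccts_const | now apply ccts_kernel].
  - intros t. rewrite !re_scal_l. pose proof (bdry_re_pos t).
    rewrite kernel_conj, re_conj by exact Hw.
    assert (/ (1 + Cmod w) <= Re (/ (1 - Cconj w * circ t))).
    { apply Re_inv_one_minus; [|exact Hw]. rewrite Cmod_mult, Cmod_conj, Cmod_circ. lra. }
    unfold Rdiv. nra.
Qed.

(** As the density has mean [1], [P w - 1] is its mean against [2 zeta / (zeta - w) - 2 = 2 w /
    (zeta - w)], where [|zeta - w| >= 1 - |w|]. *)
Lemma caratheodory_growth (w : C) : Cmod w < 1 ->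
  Cmod (P w - 1) <= 2 * Cmod w / (1 - Cmod w).
Proof.
  intros Hw. pose proof (Cmod_ge_0 w) as Hw0.
  pose proof (ccts_kernel w Hw) as HK.
  assert (E : (P w - 1)%C = cmean (fun t => RtoC (bdry_re t) *
             (RtoC 2 * (circ t * / (circ t - w)) + - RtoC 2))%C).
  { rewrite (cmean_ext _ (fun t => RtoC (bdry_re t) * (RtoC 2 * (circ t * / (circ t - w))) +
              (- RtoC 2) * RtoC (bdry_re t))%C) by (intros t; ring).
    rewrite cmean_plus, cmean_scal.
    - rewrite (herglotz w Hw).
      replace (cmean (fun t => RtoC (bdry_re t))) with (RtoC 1); [ring|].
      unfold cmean. rewrite (rmean_ext (fun t => Im (RtoC (bdry_re t))) (fun _ => 0)) by reflexivity.
      rewrite rmean_const. change (RtoC 1 = RtoC (rmean bdry_re)). now rewrite rmean_bdry_re.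
    - apply ccts_RtoC, bdry_re_rcts.
    - apply ccts_mult; [apply ccts_RtoC, bdry_re_rcts|].
      apply ccts_mult; [apply ccts_const | exact HK].
    - apply ccts_mult; [apply ccts_const | apply ccts_RtoC, bdry_re_rcts]. }
  rewrite E.
  replace (2 * Cmod w / (1 - Cmod w)) with (2 * Cmod w / (1 - Cmod w) * rmean bdry_re)
    by (rewrite rmean_bdry_re; ring).
  apply Cmod_cmean_le.
  - apply bdry_re_rcts.
  - apply ccts_plus; [|apply ccts_const]. apply ccts_mult; [apply ccts_const | exact HK].
  - apply bdry_re_pos.
  - intros t. pose proof (circ_minus_neq_0 t w Hw) as Hne.
    replace (RtoC 2 * (circ t * / (circ t - w)) + - RtoC 2)%C
      with (RtoC 2 * w * / (circ t - w))%C by (field; exact Hne).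
    rewrite !Cmod_mult, Cmod_inv, Cmod_R, Rabs_pos_eq by (auto; lra).
    apply Rmult_le_compat_l; [nra|]. apply Rinv_le_contravar; [lra|].
    pose proof (Cmod_triangle (circ t - w) w) as T.
    replace (circ t - w + w)%C with (circ t) in T by ring. rewrite Cmod_circ in T. lra.
Qed.

Lemma ccts_conj_circ_pow (m : nat) : ccts (fun t => Cconj (circ t) ^ m)%C.
Proof. intros t. apply ccont_pow, ccont_conj, ccont_circ. Qed.

Lemma cmean_conj_circ_pow (m : nat) : cmean (fun t => Cconj (circ t) ^ (S m))%C = RtoC 0.
Proof.
  rewrite (cmean_ext _ (fun t => Cconj (circ t ^ (S m)))%C)
    by (intros t; symmetry; apply Cpow_conj).
  rewrite cmean_conj by (intros t; apply ccont_pow, ccont_circ).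
  rewrite (mean_value 2 (fun z => z ^ (S m))%C) by (try apply holo_pow; lra).
  rewrite Cpow_S, Cmult_0_l. apply Cconj_RtoC.
Qed.

(** The mean of [conj P] against [conj zeta ^ (m + 1)] is the conjugate of the value of
    [P z * z^(m+1)] at [0], which is zero. So [P] may be replaced by [2 Re P], whose mean is [2].
    The constant [-1] does not change the mean either; it makes the function vanish at [0] for later
    use in [cmean_product_coef]. *)
Lemma caratheodory_coef (m : nat) :
  Cmod (cmean (fun t => (P (circ t) + - RtoC 1) * Cconj (circ t) ^ (S m)))%C <= 2.
Proof.
  pose proof bdry_re_ccts as HB. pose proof (ccts_conj_circ_pow (S m)) as HC.
  assert (Z : cmean (fun t => Cconj (P (circ t)) * Cconj (circ t) ^ (S m))%C = RtoC 0).
  { rewrite (cmean_ext _ (fun t => Cconj (P (circ t) * circ t ^ (S m)))%C)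
      by (intros t; now rewrite Cmult_conj, Cpow_conj).
    assert (Hh : holo R0 (fun z => P z * z ^ (S m))%C)
      by (apply holo_mult; [exact HP | apply holo_pow]).
    rewrite cmean_conj by (apply (ccts_holo R0 _ HR Hh)).
    rewrite (mean_value R0 (fun z => P z * z ^ (S m))%C HR Hh).
    replace (P 0 * 0 ^ (S m))%C with (RtoC 0) by (rewrite Cpow_S; ring). apply Cconj_RtoC. }
  assert (E : cmean (fun t => (P (circ t) + - RtoC 1) * Cconj (circ t) ^ (S m))%C =
              cmean (fun t => RtoC (bdry_re t) * (RtoC 2 * Cconj (circ t) ^ (S m)))%C).
  { rewrite (cmean_ext _ (fun t => P (circ t) * Cconj (circ t) ^ (S m) +
               (- RtoC 1) * Cconj (circ t) ^ (S m))%C) by (intros t; ring).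
    rewrite cmean_plus, cmean_scal, cmean_conj_circ_pow
      by auto using ccts_mult, ccts_const.
    rewrite (cmean_ext (fun t => RtoC (bdry_re t) * (RtoC 2 * Cconj (circ t) ^ (S m)))%C
      (fun t => P (circ t) * Cconj (circ t) ^ (S m) +
                Cconj (P (circ t)) * Cconj (circ t) ^ (S m))%C).
    - rewrite cmean_plus, Z by auto using ccts_mult, ccts_conj. ring.
    - intros t. rewrite <- Cmult_plus_distr_r, plus_Cconj. unfold bdry_re. ring. }
  rewrite E. apply Rle_trans with (2 * rmean bdry_re); [|rewrite rmean_bdry_re; lra].
  apply Cmod_cmean_le.
  - apply bdry_re_rcts.
  - apply ccts_mult; [apply ccts_const | exact HC].
  - apply bdry_re_pos.
  - intros t. rewrite Cmod_mult, Cmod_pow, Cmod_conj, Cmod_circ, pow1, Cmod_R, Rabs_pos_eq; lra.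
Qed.

End PositiveRealPart.

(** * Coefficients of products, and the extremal sequence *)

(** Recursion from the front matches the way [cmean_product_coef] strips a series; [psum_S] works at
    the other end. *)
Fixpoint psum (u : nat -> R) (k : nat) : R :=
  match k with O => 0 | S k' => u O + psum (fun j => u (S j)) k' end.

Lemma psum_S (u : nat -> R) (k : nat) : psum u (S k) = psum u k + u k.
Proof.
  revert u. induction k as [|k IH]; intros u; [simpl; ring|].
  change (u O + psum (fun j => u (S j)) (S k) = u O + psum (fun j => u (S j)) k + u (S k)).
  rewrite IH. ring.
Qed.

Lemma psum_le (u v : nat -> R) (k : nat) :
  (forall j, (j < k)%nat -> u j <= v j) -> psum u k <= psum v k.
Proof.
  induction k as [|k IH]; intros H; [simpl; lra|].
  rewrite !psum_S. apply Rplus_le_compat; [apply IH; intros; apply H; lia | apply H; lia].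
Qed.

(** The mean is the coefficient of [z^k] in the product, and [M] bounds the coefficients of positive
    index of [h]. The induction strips [c 0] from the second factor: it contributes [c 0] times a
    coefficient of [h], and in the rest the factor [zeta] cancels one [conj zeta]. *)
Lemma cmean_product_coef (R0 : R) (h : C -> C) (M : R) (c : nat -> C) (k : nat) :
  1 < R0 -> holo R0 h ->
  (forall m, Cmod (cmean (fun t => h (circ t) * Cconj (circ t) ^ (S m)))%C <= M) ->
  abs_conv R0 c ->
  Cmod (cmean (fun t => h (circ t) * CPSeries c (circ t) * Cconj (circ t) ^ k) - h (RtoC 0) * c k)%C
    <= M * psum (fun j => Cmod (c j)) k.
Proof.
  intros HR Hh HM. revert c. induction k as [|k IH]; intros c Hc.
  - assert (Hhc : holo R0 (fun z => h z * CPSeries c z)%C)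
      by (apply holo_mult; [exact Hh | now apply holo_CPSeries]).
    rewrite (cmean_ext _ (fun t => h (circ t) * CPSeries c (circ t))%C) by (intros t; simpl; ring).
    rewrite (mean_value R0 _ HR Hhc), (CPSeries_0 R0) by (auto; lra).
    replace (h (RtoC 0) * c O - h (RtoC 0) * c O)%C with (RtoC 0) by ring.
    rewrite Cmod_0. simpl. lra.
  - pose proof (abs_conv_shift R0 c Hc) as Hc1.
    assert (C1 : ccts (fun t => h (circ t))) by now apply (ccts_holo R0).
    assert (C2 : ccts (fun t => CPSeries (fun n => c (S n)) (circ t)))
      by (apply (ccts_holo R0); [exact HR | now apply holo_CPSeries]).
    rewrite (cmean_ext _ (fun t => c O * (h (circ t) * Cconj (circ t) ^ (S k)) +
      h (circ t) * CPSeries (fun n => c (S n)) (circ t) * Cconj (circ t) ^ k)%C).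
    + rewrite cmean_plus, cmean_scal
        by auto using ccts_mult, ccts_const, ccts_conj_circ_pow.
      set (A := cmean (fun t => h (circ t) * Cconj (circ t) ^ S k)%C).
      set (B := cmean (fun t => h (circ t) * CPSeries (fun n => c (S n)) (circ t) *
                          Cconj (circ t) ^ k)%C).
      replace (c O * A + B - h (RtoC 0) * c (S k))%C
        with (c O * A + (B - h (RtoC 0) * c (S k)))%C by ring.
      eapply Rle_trans; [apply Cmod_triangle|]. rewrite Cmod_mult.
      specialize (IH _ Hc1). fold B in IH. specialize (HM k). fold A in HM.
      pose proof (Cmod_ge_0 (c O)). cbn [psum].
      assert (Cmod (c O) * Cmod A <= Cmod (c O) * M) by (apply Rmult_le_compat_l; assumption).
      lra.
    + intros t. rewrite (CPSeries_shift R0 c) by (rewrite ?Cmod_circ; auto).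
      rewrite Cpow_S.
      replace (h (circ t) * (c O + circ t * CPSeries (fun n => c (S n)) (circ t)) *
        (Cconj (circ t) * Cconj (circ t) ^ k))%C
      with (c O * (h (circ t) * (Cconj (circ t) * Cconj (circ t) ^ k)) +
        (circ t * Cconj (circ t)) * (h (circ t) * CPSeries (fun n => c (S n)) (circ t) *
          Cconj (circ t) ^ k))%C by ring.
      rewrite circ_conj_mult. ring.
Qed.

(* Taylor coefficients of [(1 - w)^(-3/2)]. *)
Fixpoint ext_coef (k : nat) : R :=
  match k with O => 1 | S k' => ext_coef k' * (2 * INR k' + 3) / (2 * INR k' + 2) end.

Lemma ext_coef_pos (k : nat) : 0 < ext_coef k.
Proof.
  induction k as [|k IH]; [simpl; lra|]. simpl. pose proof (pos_INR k).
  apply Rdiv_lt_0_compat; [|lra]. apply Rmult_lt_0_compat; lra.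
Qed.

Lemma ext_coef_S (k : nat) : (2 * INR k + 2) * ext_coef (S k) = (2 * INR k + 3) * ext_coef k.
Proof. simpl. pose proof (pos_INR k). field. lra. Qed.

(** The extremal sequence turns the recursive inequality for [|b_k|] into an equality, which is what
    closes the induction in [coef_le_ext_coef]. *)
Lemma psum_ext_coef (k : nat) : 3 * psum ext_coef k = 2 * INR k * ext_coef k.
Proof.
  induction k as [|k IH]; [simpl; ring|].
  rewrite psum_S, Rmult_plus_distr_l, IH, S_INR. pose proof (ext_coef_S k). lra.
Qed.

(** * Bounds on the coefficients and on the logarithmic derivative *)

Section LogDerivative.
Variables (R0 : R) (b : nat -> C).
Hypotheses (HR : 1 < R0) (Hb : abs_conv R0 b) (Hb0 : b O = RtoC 1)
  (Hnz : forall w, Cmod w < R0 -> CPSeries b w <> RtoC 0).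

(* [2 w g'(w) / g(w)] for [g] with Taylor coefficients [b] *)
Definition log_der (b : nat -> C) (w : C) : C := (2 * CPSeries (euler_coef b) w / CPSeries b w)%C.

Hypothesis Hre : forall w, Cmod w < R0 -> - (3 / 2) < Re (log_der b w).

Local Definition cara (w : C) : C := (1 + RtoC (2 / 3) * log_der b w)%C.

Lemma holo_cara : holo R0 cara.
Proof.
  apply (holo_plus R0 (fun _ => RtoC 1) (fun w => RtoC (2 / 3) * log_der b w)%C);
    [apply holo_const|].
  apply (holo_mult R0 (fun _ => RtoC (2 / 3)) (log_der b)); [apply holo_const|].
  apply (holo_mult R0 (fun w => RtoC 2 * CPSeries (euler_coef b) w)%C (fun w => / CPSeries b w)%C).
  - apply (holo_mult R0 (fun _ => RtoC 2) (CPSeries (euler_coef b))); [apply holo_const|].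
    now apply holo_CPSeries, abs_conv_euler_coef.
  - apply holo_inv; [exact Hnz | now apply holo_CPSeries].
Qed.

Lemma cara_0 : cara (RtoC 0) = RtoC 1.
Proof.
  assert (H0 : Cmod (RtoC 0) < R0) by (rewrite Cmod_0; lra).
  unfold cara, log_der. rewrite (CPSeries_euler_coef R0) by assumption.
  field. now apply Hnz.
Qed.

Lemma cara_pos (z : C) : Cmod z < R0 -> 0 < Re (cara z).
Proof.
  intros Hz. specialize (Hre z Hz). unfold cara. rewrite re_plus, re_scal_l, re_RtoC. lra.
Qed.

Lemma coef_le_ext_coef (k : nat) : Cmod (b k) <= ext_coef k.
Proof.
  induction k as [k IH] using (well_founded_induction Wf_nat.lt_wf).
  destruct k as [|k]; [rewrite Hb0, Cmod_1; simpl; lra|].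
  set (n := S k) in *.
  assert (Ht : abs_conv R0 (fun j => RtoC 2 * euler_coef b j)%C) by now apply abs_conv_scal, abs_conv_euler_coef.
  (* With [h = 1] and [M = 0] the estimate becomes an exact formula for the coefficient of [w^n] in
     [2 w g']. *)
  pose proof (cmean_product_coef R0 (fun _ => RtoC 1) 0
    (fun j => RtoC 2 * euler_coef b j)%C n HR (holo_const _ _)) as L.
  assert (L0 : forall m, Cmod (cmean (fun t => RtoC 1 * Cconj (circ t) ^ (S m))%C) <= 0).
  { intros m. rewrite (cmean_ext _ (fun t => Cconj (circ t) ^ (S m))%C) by (intros t; ring).
    rewrite cmean_conj_circ_pow, Cmod_0. lra. }
  specialize (L L0 Ht). rewrite Rmult_0_l in L.
  assert (Hh : holo R0 (fun z => cara z + - RtoC 1)%C)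
    by (apply (holo_plus R0 cara (fun _ => - RtoC 1)%C); [apply holo_cara | apply holo_const]).
  (* The same coefficient, up to the factor [3/2], seen in [(P - 1) g]. As [P - 1] vanishes at [0],
     the term in [b n] drops out and only earlier coefficients remain. *)
  pose proof (cmean_product_coef R0 (fun z => cara z + - RtoC 1)%C 2 b n HR Hh
    (caratheodory_coef R0 cara HR holo_cara cara_0 cara_pos) Hb) as K.
  cbv beta in K. rewrite cara_0 in K.
  replace ((1 + - RtoC 1) * b n)%C with (RtoC 0) in K by ring.
  set (A := cmean (fun t => (cara (circ t) + - RtoC 1) * CPSeries b (circ t) *
                     Cconj (circ t) ^ n)%C) in *.
  assert (EA : cmean (fun t => RtoC 1 * CPSeries (fun j => RtoC 2 * euler_coef b j)%C (circ t) *
                        Cconj (circ t) ^ n)%C = (RtoC (3 / 2) * A)%C).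
  { unfold A. rewrite <- cmean_scal.
    - apply cmean_ext. intros t.
      assert (Hc : Cmod (circ t) < R0) by (rewrite Cmod_circ; exact HR).
      rewrite (CPSeries_scal R0) by (auto; now apply abs_conv_euler_coef).
      unfold cara, log_der.
      replace (RtoC (2 / 3)) with (RtoC 2 / RtoC 3)%C by (rewrite RtoC_div; [reflexivity|lra]).
      replace (RtoC (3 / 2)) with (RtoC 3 / RtoC 2)%C by (rewrite RtoC_div; [reflexivity|lra]).
      field. now apply Hnz.
    - apply ccts_mult; [|apply ccts_conj_circ_pow].
      apply (ccts_holo R0 (fun z => (cara z + - RtoC 1) * CPSeries b z)%C HR).
      apply holo_mult; [exact Hh | now apply holo_CPSeries]. }
  rewrite EA in L.
  assert (EL : (RtoC (3 / 2) * A = RtoC 1 * (RtoC 2 * euler_coef b n))%C).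
  { apply Ceq_minus, Cmod_eq_0. pose proof (Cmod_ge_0
      (RtoC (3 / 2) * A - RtoC 1 * (RtoC 2 * euler_coef b n))%C). lra. }
  apply (f_equal Cmod) in EL. unfold euler_coef in EL.
  rewrite !Cmod_mult, !Cmod_R, !Rabs_pos_eq in EL by (try apply pos_INR; lra).
  replace (A - RtoC 0)%C with A in K by ring.
  assert (Hs : psum (fun j => Cmod (b j)) n <= psum ext_coef n)
    by (apply psum_le; intros j Hj; now apply IH).
  pose proof (psum_ext_coef n).
  assert (Hn : 0 < INR n) by (apply lt_0_INR; unfold n; lia).
  apply Rmult_le_reg_l with (2 * INR n); lra.
Qed.

(** At [|w| = 2/9] the lower bound for [Re P] is [2 / (11/9) - 1 = 7/11] and the bound for [|P - 1|]
    is [(4/9) / (7/9) = 4/7]; then [Q = (3/2) (P - 1)]. *)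
Lemma log_der_bounds (w : C) : Cmod w < 2 / 9 ->
  - (6 / 11) <= Re (log_der b w) /\ Cmod (log_der b w) <= 6 / 7.
Proof.
  intros Hw. assert (Hw1 : Cmod w < 1) by lra. pose proof (Cmod_ge_0 w).
  pose proof (harnack_lower R0 cara HR holo_cara cara_0 cara_pos w Hw1) as H1.
  pose proof (caratheodory_growth R0 cara HR holo_cara cara_0 cara_pos w Hw1) as H2.
  split.
  - unfold cara in H1. rewrite re_plus, re_scal_l, re_RtoC in H1.
    assert (18 / 11 <= 2 / (1 + Cmod w)).
    { apply Rmult_le_reg_r with (1 + Cmod w); [lra|].
      replace (2 / (1 + Cmod w) * (1 + Cmod w)) with 2 by (field; lra). lra. }
    lra.
  - unfold cara in H2. replace (1 + RtoC (2 / 3) * log_der b w - 1)%C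
      with (RtoC (2 / 3) * log_der b w)%C in H2 by ring.
    rewrite Cmod_mult, Cmod_R, Rabs_pos_eq in H2 by lra.
    assert (2 * Cmod w / (1 - Cmod w) <= 4 / 7).
    { apply Rmult_le_reg_r with (1 - Cmod w); [lra|].
      replace (2 * Cmod w / (1 - Cmod w) * (1 - Cmod w)) with (2 * Cmod w) by (field; lra). lra. }
    lra.
Qed.

End LogDerivative.

(** * Sections of the power series for [|w| < 2/9] *)

(** A section remains an infinite sequence, so that the results on [CPSeries] and [log_der] apply to
    it unchanged. *)
Definition trunc (n : nat) (a : nat -> C) (k : nat) : C :=
  if Nat.ltb k n then a k else RtoC 0.

Definition rest (n : nat) (a : nat -> C) (k : nat) : C :=
  if Nat.ltb k n then RtoC 0 else a k.

Lemma Cmod_trunc_le (n : nat) (a : nat -> C) (k : nat) : Cmod (trunc n a k) <= Cmod (a k).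
Proof.
  unfold trunc. destruct (Nat.ltb k n); [lra|]. rewrite Cmod_0. apply Cmod_ge_0.
Qed.

Lemma Cmod_rest_le (n : nat) (a : nat -> C) (k : nat) : Cmod (rest n a k) <= Cmod (a k).
Proof.
  unfold rest. destruct (Nat.ltb k n); [|lra]. rewrite Cmod_0. apply Cmod_ge_0.
Qed.

Lemma abs_conv_trunc (R0 : R) (n : nat) (a : nat -> C) : abs_conv R0 a -> abs_conv R0 (trunc n a).
Proof. apply abs_conv_le, Cmod_trunc_le. Qed.

Lemma abs_conv_rest (R0 : R) (n : nat) (a : nat -> C) : abs_conv R0 a -> abs_conv R0 (rest n a).
Proof. apply abs_conv_le, Cmod_rest_le. Qed.

Lemma CPSeries_null (a : nat -> C) (z : C) : (forall k, a k = RtoC 0) -> CPSeries a z = RtoC 0.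
Proof.
  intros H. apply Cmod_eq_0. pose proof (Cmod_ge_0 (CPSeries a z)).
  assert (Cmod (CPSeries a z) <= 0 / (1 - 0)); [|lra].
  apply Cmod_CPSeries_geom; [lra|]. intros k. rewrite H, Cmod_0. lra.
Qed.

Lemma CPSeries_linear (R0 : R) (a : nat -> C) (z : C) : abs_conv R0 a -> Cmod z < R0 ->
  (forall k, a (S (S k)) = RtoC 0) -> CPSeries a z = (a 0%nat + a 1%nat * z)%C.
Proof.
  intros Ha Hz H. pose proof (abs_conv_shift R0 a Ha) as Ha1.
  rewrite (CPSeries_shift R0 a z Ha Hz), (CPSeries_shift R0 _ z Ha1 Hz), CPSeries_null by exact H. ring.
Qed.

Lemma CPSeries_split3 (R0 : R) (a : nat -> C) (z : C) : abs_conv R0 a -> Cmod z < R0 ->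
  CPSeries a z = (a 0%nat + a 1%nat * z + a 2%nat * (z * z) +
             z * z * z * CPSeries (fun k => a (S (S (S k)))) z)%C.
Proof.
  intros Ha Hz. pose proof (abs_conv_shift R0 a Ha) as Ha1. pose proof (abs_conv_shift R0 _ Ha1) as Ha2.
  rewrite (CPSeries_shift R0 a z Ha Hz), (CPSeries_shift R0 _ z Ha1 Hz), (CPSeries_shift R0 _ z Ha2 Hz). ring.
Qed.

Lemma Cmod_cubic_tail (a : nat -> C) (z : C) (A p : R) : Cmod z < 2 / 9 -> 0 <= p ->
  p * (2 / 9) < 1 -> (forall k, Cmod (a (S (S (S k)))) <= A * p ^ k) ->
  Cmod (z * z * z * CPSeries (fun k => a (S (S (S k)))) z) <= (2 / 9) ^ 3 * (A / (1 - p * (2 / 9))).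
Proof.
  intros Hz Hp Hq H. pose proof (Cmod_ge_0 z).
  rewrite !Cmod_mult.
  replace (Cmod z * Cmod z * Cmod z) with (Cmod z ^ 3) by ring.
  apply Rmult_le_compat; [apply pow_le; lra | apply Cmod_ge_0 | apply pow_incr; lra |].
  apply Cmod_CPSeries_geom; [split; nra|]. intros k.
  rewrite Rpow_mult_distr, <- Rmult_assoc.
  apply Rmult_le_compat; [apply Cmod_ge_0 | apply pow_le; lra | apply H | apply pow_incr; lra].
Qed.

(** The entry of index [3] is [35/16], and the ratio [(2m + 3) / (2m + 2)] is at most [9/8] from
    [m = 3] on. *)
Lemma ext_coef_tail (k : nat) : ext_coef (S (S (S k))) <= 35 / 16 * (9 / 8) ^ k.
Proof.
  induction k as [|k IH]; [simpl; lra|].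
  set (m := S (S (S k))) in *. pose proof (ext_coef_S m) as E. pose proof (ext_coef_pos m).
  assert (Hm : 3 <= INR m) by (unfold m; rewrite !S_INR; pose proof (pos_INR k); lra).
  assert (B : ext_coef (S m) <= 9 / 8 * ext_coef m).
  { apply Rmult_le_reg_l with (2 * INR m + 2); [lra|]. rewrite E. nra. }
  simpl pow. lra.
Qed.

(** The sequence starts at [3 * 35/16], and its ratio [(2m + 3) / (2m)] is at most [3/2] from
    [m = 3] on. *)
Lemma mult_ext_coef_tail (k : nat) :
  INR (S (S (S k))) * ext_coef (S (S (S k))) <= 105 / 16 * (3 / 2) ^ k.
Proof.
  induction k as [|k IH]; [simpl; lra|].
  set (m := S (S (S k))) in *. pose proof (ext_coef_S m) as E. pose proof (ext_coef_pos m).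
  assert (Hm : 3 <= INR m) by (unfold m; rewrite !S_INR; pose proof (pos_INR k); lra).
  assert (B : INR (S m) * ext_coef (S m) <= 3 / 2 * (INR m * ext_coef m)) by (rewrite S_INR; nra).
  simpl pow. lra.
Qed.

Section SectionBound.
Variables (R0 : R) (b : nat -> C).
Hypotheses (HR : 1 < R0) (Hb : abs_conv R0 b) (Hb0 : b O = RtoC 1)
  (Hnz : forall w, Cmod w < R0 -> CPSeries b w <> RtoC 0)
  (Hre : forall w, Cmod w < R0 -> - (3 / 2) < Re (log_der b w)).
Variable w : C.
Hypothesis Hw : Cmod w < 2 / 9.

Let Hbk (k : nat) : Cmod (b k) <= ext_coef k := coef_le_ext_coef R0 b HR Hb Hb0 Hnz Hre k.

(** The section is [1 + v] with [|v| < (3/2) (2/9) = 1/3], so [|2 v| < 2/3 < |1 + v|]. The value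
    [2/9] leaves no slack here. *)
Lemma section_log_der_small (n : nat) : (1 <= n <= 2)%nat ->
  CPSeries (trunc n b) w <> RtoC 0 /\ -1 < Re (log_der (trunc n b) w).
Proof.
  intros Hn. assert (Hw1 : Cmod w < R0) by lra.
  assert (Z : forall k, trunc n b (S (S k)) = RtoC 0).
  { intros k. unfold trunc. destruct (Nat.ltb_spec (S (S k)) n); [lia | reflexivity]. }
  pose proof (abs_conv_trunc R0 n b Hb) as Ht.
  unfold log_der. rewrite (CPSeries_linear R0 _ w Ht Hw1 Z).
  rewrite (CPSeries_linear R0 (euler_coef (trunc n b)) w (abs_conv_euler_coef _ _ Ht) Hw1)
    by (intros k; unfold euler_coef; rewrite Z; ring).
  replace (trunc n b 0) with (RtoC 1)
    by (unfold trunc; destruct (Nat.ltb_spec 0 n); [now rewrite Hb0 | lia]).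
  unfold euler_coef; simpl INR.
  set (v := (trunc n b 1 * w)%C).
  assert (Hv : Cmod v < 1 / 3).
  { unfold v. rewrite Cmod_mult. pose proof (Cmod_trunc_le n b 1). pose proof (Hbk 1) as H1.
    simpl in H1. pose proof (Cmod_ge_0 (trunc n b 1)). pose proof (Cmod_ge_0 w). nra. }
  assert (Hd : 2 / 3 < Cmod (1 + v)).
  { pose proof (Cmod_triangle (1 + v) (- v)) as T.
    replace (1 + v + - v)%C with (RtoC 1) in T by ring.
    rewrite Cmod_opp, Cmod_1 in T. lra. }
  assert (Hd0 : (1 + v)%C <> RtoC 0) by (apply Cmod_gt_0; lra).
  split; [exact Hd0|].
  replace (2 * (RtoC 0 * trunc n b 0 + RtoC 1 * trunc n b 1 * w) / (1 + v))%C
    with (RtoC 2 * v / (1 + v))%C by (unfold v; field; exact Hd0).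
  assert (Hq : Cmod (RtoC 2 * v / (1 + v)) < 1).
  { rewrite Cmod_div, Cmod_mult, Cmod_R, Rabs_pos_eq by (auto; lra).
    apply Rmult_lt_reg_r with (Cmod (1 + v)); [lra|].
    replace (2 * Cmod v / Cmod (1 + v) * Cmod (1 + v)) with (2 * Cmod v) by (field; lra). lra. }
  pose proof (re_le_Cmod (RtoC 2 * v / (1 + v))) as Hre'. apply Rabs_le_between in Hre'. lra.
Qed.

(* With [r = g - S], the difference of the logarithmic derivatives of [S] and
   [g] is [(Q r - 2 w r') / S], which is less than [5/11] in modulus. *)
Lemma section_log_der_large (n : nat) : (3 <= n)%nat ->
  CPSeries (trunc n b) w <> RtoC 0 /\ -1 < Re (log_der (trunc n b) w).
Proof.
  intros Hn. assert (Hw1 : Cmod w < R0) by lra. pose proof (Cmod_ge_0 w) as Hw0.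
  pose proof (abs_conv_trunc R0 n b Hb) as Ht. pose proof (abs_conv_rest R0 n b Hb) as Hr.
  destruct (log_der_bounds R0 b HR Hb Hnz Hre w Hw) as [Q1 Q2].
  set (S := CPSeries (trunc n b) w). set (r := CPSeries (rest n b) w).
  set (tS := CPSeries (euler_coef (trunc n b)) w). set (tr := CPSeries (euler_coef (rest n b)) w).
  assert (Eg : CPSeries b w = (S + r)%C).
  { unfold S, r. rewrite <- (CPSeries_plus R0) by assumption. apply CPSeries_ext. intros k.
    unfold trunc, rest. destruct (Nat.ltb k n); ring. }
  assert (Et : CPSeries (euler_coef b) w = (tS + tr)%C).
  { unfold tS, tr. rewrite <- (CPSeries_plus R0) by auto using abs_conv_euler_coef. apply CPSeries_ext. intros k.
    unfold euler_coef, trunc, rest. destruct (Nat.ltb k n); ring. }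
  assert (Z : forall k, (k < 3)%nat -> rest n b k = RtoC 0).
  { intros k Hk. unfold rest. destruct (Nat.ltb_spec k n); [reflexivity | lia]. }
  assert (T : forall k, (k < 3)%nat -> trunc n b k = b k).
  { intros k Hk. unfold trunc. destruct (Nat.ltb_spec k n); [reflexivity | lia]. }
  assert (Br : Cmod r <= (2 / 9) ^ 3 * (35 / 16 / (1 - 9 / 8 * (2 / 9)))).
  { unfold r. rewrite (CPSeries_split3 R0) by assumption. rewrite !Z by lia.
    rewrite !Cmult_0_l, !Cplus_0_l.
    apply Cmod_cubic_tail; [exact Hw | lra | lra |]. intros k.
    eapply Rle_trans; [apply Cmod_rest_le|]. eapply Rle_trans; [apply Hbk | apply ext_coef_tail]. }
  assert (Btr : Cmod tr <= (2 / 9) ^ 3 * (105 / 16 / (1 - 3 / 2 * (2 / 9)))).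
  { unfold tr. rewrite (CPSeries_split3 R0) by auto using abs_conv_euler_coef.
    unfold euler_coef at 1 2 3. rewrite !Z by lia.
    rewrite !Cmult_0_r, !Cmult_0_l, !Cplus_0_l.
    apply Cmod_cubic_tail; [exact Hw | lra | lra |]. intros k.
    unfold euler_coef. rewrite Cmod_mult, Cmod_R, Rabs_pos_eq by apply pos_INR.
    eapply Rle_trans; [|apply mult_ext_coef_tail].
    apply Rmult_le_compat_l; [apply pos_INR|].
    eapply Rle_trans; [apply Cmod_rest_le | apply Hbk]. }
  (* The terms of index [1] and [2] are at most [(3/2) (2/9) = 1/3] and [(15/8) (2/9)^2 = 5/54]. *)
  assert (BS : 1 - 1 / 3 - 5 / 54 - (2 / 9) ^ 3 * (35 / 16 / (1 - 9 / 8 * (2 / 9))) <= Cmod S).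
  { unfold S. rewrite (CPSeries_split3 R0) by assumption. rewrite !T by lia. rewrite Hb0.
    set (X := (w * w * w * CPSeries (fun k => trunc n b (Datatypes.S (Datatypes.S (Datatypes.S k)))) w)%C).
    assert (BX : Cmod X <= (2 / 9) ^ 3 * (35 / 16 / (1 - 9 / 8 * (2 / 9)))).
    { apply Cmod_cubic_tail; [exact Hw | lra | lra |]. intros k.
      eapply Rle_trans; [apply Cmod_trunc_le|]. eapply Rle_trans; [apply Hbk | apply ext_coef_tail]. }
    assert (B1 : Cmod (b 1%nat * w) <= 1 / 3).
    { rewrite Cmod_mult. pose proof (Hbk 1) as H1. simpl in H1.
      pose proof (Cmod_ge_0 (b 1%nat)). nra. }
    assert (B2 : Cmod (b 2%nat * (w * w)) <= 5 / 54).
    { rewrite !Cmod_mult. pose proof (Hbk 2) as H2. simpl in H2.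
      pose proof (Cmod_ge_0 (b 2%nat)).
      assert (Cmod w * Cmod w <= 4 / 81) by nra. nra. }
    pose proof (Cmod_triangle (1 + b 1%nat * w + b 2%nat * (w * w) + X) (- X)) as T3.
    replace (1 + b 1%nat * w + b 2%nat * (w * w) + X + - X)%C
      with (1 + b 1%nat * w + b 2%nat * (w * w))%C in T3 by ring.
    pose proof (Cmod_triangle (1 + b 1%nat * w + b 2%nat * (w * w)) (- (b 2%nat * (w * w)))) as T2.
    replace (1 + b 1%nat * w + b 2%nat * (w * w) + - (b 2%nat * (w * w)))%C
      with (1 + b 1%nat * w)%C in T2 by ring.
    pose proof (Cmod_triangle (1 + b 1%nat * w) (- (b 1%nat * w))) as T1.
    replace (1 + b 1%nat * w + - (b 1%nat * w))%C with (RtoC 1) in T1 by ring.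
    rewrite Cmod_opp in T1, T2, T3. rewrite Cmod_1 in T1. lra. }
  assert (HS : 0 < Cmod S) by lra.
  assert (HS0 : S <> RtoC 0) by (now apply Cmod_gt_0).
  split; [exact HS0|].
  set (Q := log_der b w) in *.
  assert (EQ : (2 * (tS + tr) = Q * (S + r))%C).
  { unfold Q, log_der. rewrite <- Eg, <- Et. field. now apply Hnz. }
  assert (ED : log_der (trunc n b) w = (Q + (Q * r - 2 * tr) / S)%C).
  { unfold log_der. fold S tS.
    replace (2 * tS)%C with (Q * (S + r) - 2 * tr)%C by (rewrite <- EQ; ring).
    field. exact HS0. }
  rewrite ED, re_plus.
  (* Numerically the bounds give [(6/7 * 0.0320 + 2 * 0.1080) / 0.5421], about [0.449]. *)
  assert (HD : Cmod ((Q * r - 2 * tr) / S) < 5 / 11).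
  { rewrite Cmod_div by exact HS0. apply Rmult_lt_reg_r with (Cmod S); [exact HS|].
    replace (Cmod (Q * r - 2 * tr) / Cmod S * Cmod S) with (Cmod (Q * r - 2 * tr))
      by (field; lra).
    eapply Rle_lt_trans; [apply Cmod_triangle|].
    rewrite Cmod_opp, !Cmod_mult, Cmod_R, Rabs_pos_eq by lra.
    pose proof (Cmod_ge_0 r). pose proof (Cmod_ge_0 Q).
    assert (Cmod Q * Cmod r <= 6 / 7 * Cmod r) by nra. lra. }
  pose proof (re_le_Cmod ((Q * r - 2 * tr) / S)) as HX. apply Rabs_le_between in HX. lra.
Qed.

Lemma section_log_der (n : nat) : (1 <= n)%nat ->
  CPSeries (trunc n b) w <> RtoC 0 /\ -1 < Re (log_der (trunc n b) w).
Proof.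
  intros Hn. destruct (Nat.le_gt_cases n 2).
  - apply section_log_der_small. lia.
  - apply section_log_der_large. lia.
Qed.

End SectionBound.

(** * Dilation, and the bound for functions on the open unit disk *)

Definition rescale (rho : R) (a : nat -> C) (k : nat) : C := (a k * RtoC rho ^ k)%C.

Lemma CPSeries_rescale (rho : R) (a : nat -> C) (z : C) :
  CPSeries (rescale rho a) z = CPSeries a (RtoC rho * z).
Proof.
  apply CSeries_ext. intros k. unfold rescale. rewrite Cpow_mult_l. ring.
Qed.

Lemma abs_conv_rescale (rho : R) (a : nat -> C) : 0 < rho -> abs_conv 1 a -> abs_conv (/ rho) (rescale rho a).
Proof.
  intros Hrho Ha r Hr.
  apply ex_series_ext with (fun k => Cmod (a k) * (rho * r) ^ k).
  - intros k. unfold rescale. rewrite Cmod_mult, Cmod_pow, Cmod_R, Rabs_pos_eq by lra.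
    rewrite Rpow_mult_distr. simpl. ring.
  - apply Ha. split; [nra|].
    replace 1 with (rho * / rho) by (field; lra). nra.
Qed.

Lemma log_der_rescale (rho : R) (a : nat -> C) (z : C) :
  log_der (rescale rho a) z = log_der a (RtoC rho * z).
Proof.
  unfold log_der. rewrite <- !CPSeries_rescale.
  rewrite (CPSeries_ext (euler_coef (rescale rho a)) (rescale rho (euler_coef a)))
    by (intros k; unfold euler_coef, rescale; ring).
  reflexivity.
Qed.

Lemma trunc_rescale (n : nat) (rho : R) (a : nat -> C) (k : nat) :
  trunc n (rescale rho a) k = rescale rho (trunc n a) k.
Proof. unfold trunc, rescale. destruct (Nat.ltb k n); ring. Qed.

Lemma log_der_ext (a b : nat -> C) (z : C) : (forall k, a k = b k) -> log_der a z = log_der b z.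
Proof.
  intros H. unfold log_der. rewrite (CPSeries_ext a b) by exact H.
  rewrite (CPSeries_ext (euler_coef a) (euler_coef b)) by (intros k; unfold euler_coef; now rewrite H). reflexivity.
Qed.

(* Rescaling makes [g] analytic in a neighbourhood of the closed unit disk. *)
Lemma section_log_der_unit_disk (b : nat -> C) (w : C) (n : nat) :
  abs_conv 1 b -> b O = RtoC 1 ->
  (forall w, Cmod w < 1 -> CPSeries b w <> RtoC 0) ->
  (forall w, Cmod w < 1 -> - (3 / 2) < Re (log_der b w)) ->
  Cmod w < 2 / 9 -> (1 <= n)%nat ->
  CPSeries (trunc n b) w <> RtoC 0 /\ -1 < Re (log_der (trunc n b) w).
Proof.
  intros Hb Hb0 Hnz Hre Hw Hn. pose proof (Cmod_ge_0 w) as Hw0.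
  (* The midpoint of [9/2 |w|] and [1]: below [1], and still large enough that [|w| / rho < 2/9]. *)
  set (rho := (9 / 2 * Cmod w + 1) / 2).
  assert (Hrho : 0 < rho < 1) by (unfold rho; lra).
  assert (Hwr : 9 / 2 * Cmod w < rho) by (unfold rho; lra).
  assert (Hrn : RtoC rho <> RtoC 0) by (intros E; apply RtoC_inj in E; lra).
  assert (HR : 1 < / rho) by (rewrite <- Rinv_1; apply Rinv_lt_contravar; lra).
  assert (Hin : forall v, Cmod v < / rho -> Cmod (RtoC rho * v) < 1).
  { intros v Hv. rewrite Cmod_mult, Cmod_R, Rabs_pos_eq by lra.
    replace 1 with (rho * / rho) by (field; lra). apply Rmult_lt_compat_l; lra. }
  set (v := (w / RtoC rho)%C).
  assert (Ev : (RtoC rho * v)%C = w) by (unfold v; field; exact Hrn).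
  assert (Hv : Cmod v < 2 / 9).
  { unfold v. rewrite Cmod_div, Cmod_R, Rabs_pos_eq by (auto; lra).
    apply Rmult_lt_reg_r with rho; [lra|].
    replace (Cmod w / rho * rho) with (Cmod w) by (field; lra). lra. }
  destruct (section_log_der (/ rho) (rescale rho b) HR) with (w := v) (n := n) as [H1 H2];
    auto.
  - apply abs_conv_rescale; [lra | exact Hb].
  - unfold rescale. rewrite Hb0. simpl. ring.
  - intros u Hu. rewrite CPSeries_rescale. apply Hnz, Hin, Hu.
  - intros u Hu. rewrite log_der_rescale. apply Hre, Hin, Hu.
  - rewrite (CPSeries_ext _ (rescale rho (trunc n b))) in H1 by (intros; apply trunc_rescale).
    rewrite (log_der_ext _ (rescale rho (trunc n b))) in H2 by (intros; apply trunc_rescale).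
    rewrite CPSeries_rescale, Ev in H1. rewrite log_der_rescale, Ev in H2. auto.
Qed.

(** * From odd functions to power series in [z^2] *)

(** If [f z] is [z] times the series [al] at [z^2], these are the coefficients [(2k + 1) al_k] of
    [f'] as a series in [z^2]. *)
Definition odd_der_coef (al : nat -> C) (k : nat) : C := (al k + RtoC 2 * euler_coef al k)%C.

Lemma abs_conv_odd_der_coef (R0 : R) (al : nat -> C) : abs_conv R0 al -> abs_conv R0 (odd_der_coef al).
Proof.
  intros H. apply (abs_conv_plus R0 al (fun k => RtoC 2 * euler_coef al k)%C); [exact H|].
  now apply abs_conv_scal, abs_conv_euler_coef.
Qed.

Lemma Cmod_square_lt_1 (z : C) : Cmod z < 1 -> Cmod (z * z) < 1.
Proof. intros H. rewrite Cmod_mult. pose proof (Cmod_ge_0 z). nra. Qed.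

Lemma Cder_square (z : C) : Cder (fun y => y * y)%C z (2 * z)%C.
Proof.
  apply (Cder_val _ z (1 * z + z * 1)%C); [ring|].
  apply (Cder_mult (fun y => y) (fun y => y)); apply Cder_id.
Qed.

Section OddFunction.
Variables (F : C -> C) (al : nat -> C).
Hypotheses (Hal : abs_conv 1 al)
  (HF : forall z, Cmod z < 1 -> F z = (z * CPSeries al (z * z))%C).

(** [F] stands for the given function, for its polynomial sections and for the extremal function
    alike. *)
Lemma odd_Cder (z : C) : Cmod z < 1 -> Cder F z (CPSeries (odd_der_coef al) (z * z)).
Proof.
  intros Hz. pose proof (Cmod_square_lt_1 z Hz) as Hw.
  apply (Cder_ext_loc (fun z => z * CPSeries al (z * z))%C F z _ 1 Hz).
  { intros y Hy. symmetry. now apply HF. }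
  apply (Cder_val _ z (1 * CPSeries al (z * z) + z * ((2 * z) * CPSeries (derive_coef al) (z * z)))%C).
  - unfold odd_der_coef. rewrite (CPSeries_plus 1), (CPSeries_scal 1), (CPSeries_euler_coef 1)
      by auto using abs_conv_euler_coef, abs_conv_scal. ring.
  - apply (Cder_mult (fun y => y) (fun y => CPSeries al (y * y))); [apply Cder_id|].
    apply (Cder_comp (CPSeries al) (fun y => y * y)%C); [|apply Cder_square].
    now apply (CPSeries_derive 1).
Qed.

Lemma odd_C_derive (z : C) : Cmod z < 1 -> C_derive F z = CPSeries (odd_der_coef al) (z * z).
Proof. intros Hz. now apply Cder_C_derive, odd_Cder. Qed.

Lemma odd_convexity_quotient (z : C) : Cmod z < 1 ->
  convexity_quotient F z = (1 + log_der (odd_der_coef al) (z * z))%C.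
Proof.
  intros Hz. pose proof (Cmod_square_lt_1 z Hz) as Hw.
  pose proof (abs_conv_odd_der_coef 1 al Hal) as Hbe.
  assert (D : C_derive (C_derive F) z = ((2 * z) * CPSeries (derive_coef (odd_der_coef al)) (z * z))%C).
  { apply Cder_C_derive.
    apply (Cder_ext_loc (fun y => CPSeries (odd_der_coef al) (y * y)) _ z _ 1 Hz).
    - intros y Hy. symmetry. now apply odd_C_derive.
    - apply (Cder_comp (CPSeries (odd_der_coef al)) (fun y => y * y)%C); [|apply Cder_square].
      now apply (CPSeries_derive 1). }
  unfold convexity_quotient, log_der. rewrite D, odd_C_derive, (CPSeries_euler_coef 1) by assumption.
  unfold Cdiv. ring.
Qed.

End OddFunction.

(** Carries the hypotheses on [f], indexed by [z], over to every [w] in the disk. The parts of the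
    root are [sqrt ((|w| + Re w) / 2)] and [sqrt ((|w| - Re w) / 2)], the latter with the sign of
    [Im w]. *)
Lemma complex_sqrt (w : C) : exists z : C, (z * z)%C = w.
Proof.
  pose proof (re_le_Cmod w) as Hre. apply Rabs_le_between in Hre.
  pose proof (Cmod2_alt w) as E. destruct w as [a b]. simpl in Hre, E.
  set (r := Cmod (a, b)) in *.
  assert (H1 : 0 <= (r + a) / 2) by lra. assert (H2 : 0 <= (r - a) / 2) by lra.
  pose proof (sqrt_sqrt _ H1) as S1. pose proof (sqrt_sqrt _ H2) as S2.
  assert (S3 : sqrt ((r + a) / 2) * sqrt ((r - a) / 2) = Rabs b / 2).
  { rewrite <- sqrt_mult by assumption.
    replace ((r + a) / 2 * ((r - a) / 2)) with (Rsqr (b / 2)) by (unfold Rsqr; nra).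
    rewrite sqrt_Rsqr_abs. unfold Rdiv. rewrite Rabs_mult, (Rabs_pos_eq (/ 2)) by lra.
    reflexivity. }
  destruct (Rle_dec 0 b) as [Hb|Hb].
  - exists (sqrt ((r + a) / 2), sqrt ((r - a) / 2)). unfold Cmult; simpl.
    rewrite Rabs_pos_eq in S3 by exact Hb. f_equal; lra.
  - exists (sqrt ((r + a) / 2), - sqrt ((r - a) / 2)). unfold Cmult; simpl.
    rewrite Rabs_left in S3 by lra. f_equal; lra.
Qed.

Definition monomial_coef (n : nat) (c : C) (k : nat) : C := if Nat.eqb k n then c else RtoC 0.

Lemma abs_conv_finite (R0 : R) (N : nat) (a : nat -> C) :
  (forall k, (N <= k)%nat -> a k = RtoC 0) -> abs_conv R0 a.
Proof.
  intros H r Hr. apply (ex_series_incr_n _ N).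
  apply ex_series_Rle with (fun k => (1 / 2) ^ k).
  - intros k. rewrite H, Cmod_0, Rmult_0_l by lia. split; [lra|]. apply pow_le. lra.
  - apply ex_series_geom. rewrite Rabs_pos_eq; lra.
Qed.

Lemma abs_conv_monomial_coef (R0 : R) (n : nat) (c : C) : abs_conv R0 (monomial_coef n c).
Proof.
  apply abs_conv_finite with (S n). intros k Hk. unfold monomial_coef.
  destruct (Nat.eqb_spec k n); [lia | reflexivity].
Qed.

Lemma CPSeries_monomial_coef (n : nat) (c z : C) : CPSeries (monomial_coef n c) z = (c * z ^ n)%C.
Proof.
  assert (Hz : Cmod z < Cmod z + 1) by lra.
  induction n as [|n IH]; rewrite (CPSeries_shift _ _ z (abs_conv_monomial_coef _ _ _) Hz).
  - rewrite CPSeries_null by reflexivity. unfold monomial_coef. simpl. ring.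
  - rewrite (CPSeries_ext _ (monomial_coef n c)) by reflexivity. rewrite IH. unfold monomial_coef. simpl. ring.
Qed.

Lemma abs_conv_trunc_any (R0 : R) (n : nat) (a : nat -> C) : abs_conv R0 (trunc n a).
Proof.
  apply abs_conv_finite with n. intros k Hk. unfold trunc.
  destruct (Nat.ltb_spec k n); [lia | reflexivity].
Qed.

Lemma CPSeries_trunc_S (n : nat) (a : nat -> C) (z : C) :
  CPSeries (trunc (S n) a) z = (CPSeries (trunc n a) z + a n * z ^ n)%C.
Proof.
  rewrite <- CPSeries_monomial_coef.
  rewrite <- (CPSeries_plus (Cmod z + 1)) by (try apply abs_conv_trunc_any; try apply abs_conv_monomial_coef; lra).
  apply CPSeries_ext. intros k. unfold trunc, monomial_coef.
  destruct (Nat.ltb_spec k (S n)), (Nat.ltb_spec k n), (Nat.eqb_spec k n); try lia; subst; ring.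
Qed.

(* Coefficients of [f(z) / z] as a power series in [z^2]. *)
Definition even_coef (a : nat -> C) (k : nat) : C :=
  match k with O => RtoC 1 | S _ => a (2 * k + 1)%nat end.

Lemma odd_pow (z : C) (k : nat) : (z ^ (2 * k + 1) = z * (z * z) ^ k)%C.
Proof.
  rewrite Cpow_add_r, Cpow_mult_r, Cpow_1_r.
  replace (z ^ 2)%C with (z * z)%C by (simpl; ring). ring.
Qed.

Lemma odd_section_CPSeries (a : nat -> C) (n : nat) (z : C) : (1 <= n)%nat ->
  odd_section a n z = (z * CPSeries (trunc n (even_coef a)) (z * z))%C.
Proof.
  intros Hn. destruct n as [|n]; [lia|]. clear Hn. unfold odd_section.
  induction n as [|n IH].
  - rewrite sum_n_m_zero by lia. rewrite CPSeries_trunc_S, CPSeries_null by (intros k; reflexivity).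
    change (z + RtoC 0 = z * (RtoC 0 + RtoC 1 * RtoC 1))%C. ring.
  - rewrite sum_n_Sm by lia. rewrite CPSeries_trunc_S, Cmult_plus_distr_l, <- IH.
    set (X := sum_n_m _ 2 (S n)). cbv beta.
    replace (2 * S (S n) - 1)%nat with (2 * S n + 1)%nat by lia.
    rewrite odd_pow. cbn [even_coef].
    change (z + (X + a (2 * S n + 1)%nat * (z * (z * z) ^ S n)) =
            z + X + z * (a (2 * S n + 1)%nat * (z * z) ^ S n))%C. ring.
Qed.

Lemma odd_der_coef_trunc (n : nat) (al : nat -> C) (k : nat) :
  odd_der_coef (trunc n al) k = trunc n (odd_der_coef al) k.
Proof. unfold odd_der_coef, euler_coef, trunc. destruct (Nat.ltb k n); ring. Qed.

(** Division by [z] and a constant term [1] in front turn the expansion of [f z - z] into a series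
    in [z^2]; its summand [j] becomes the one of index [S j]. *)
Lemma odd_expansion_series (f : C -> C) (a : nat -> C) (z : C) :
  odd_expansion f a -> Cmod z < 1 -> z <> RtoC 0 ->
  Cis_series (fun k => even_coef a k * (z * z) ^ k)%C (f z / z)%C.
Proof.
  intros Hexp Hz Hz0. specialize (Hexp z Hz).
  apply (is_series_decr_1 (K := C_AbsRing) (V := C_NormedModule)).
  pose proof (is_series_scal (K := C_AbsRing) (V := C_NormedModule) (/ z)%C _ _ Hexp) as H.
  match goal with |- is_series _ ?l => replace l with (scal (/ z)%C (f z - z)%C : C) end.
  - eapply is_series_ext; [|exact H]. intros j. cbv beta zeta.
    replace (2 * (j + 2) - 1)%nat with (2 * S j + 1)%nat by lia.
    rewrite odd_pow.
    change (/ z * (a (2 * S j + 1)%nat * (z * (z * z) ^ S j)) =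
            a (2 * S j + 1)%nat * (z * z) ^ S j)%C.
    field. exact Hz0.
  - change (/ z * (f z - z) = f z / z + - (RtoC 1 * RtoC 1))%C. field. exact Hz0.
Qed.

(** The real point [r] of the [z^2]-plane is reached from [z = sqrt r]. *)
Lemma abs_conv_even_coef (f : C -> C) (a : nat -> C) : odd_expansion f a -> abs_conv 1 (even_coef a).
Proof.
  intros Hexp. apply abs_conv_of_real_points. intros r Hr.
  assert (Hs : 0 < sqrt r < 1).
  { split; [apply sqrt_lt_R0; lra|]. rewrite <- sqrt_1. apply sqrt_lt_1; lra. }
  exists (f (RtoC (sqrt r)) / RtoC (sqrt r))%C.
  replace (RtoC r) with (RtoC (sqrt r) * RtoC (sqrt r))%C
    by (rewrite <- RtoC_mult, sqrt_sqrt by lra; reflexivity).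
  apply odd_expansion_series; [exact Hexp | |].
  - rewrite Cmod_R, Rabs_pos_eq; lra.
  - intros E. apply RtoC_inj in E. lra.
Qed.

Lemma class_L_CPSeries (f : C -> C) (a : nat -> C) (z : C) :
  class_L f -> odd_expansion f a -> Cmod z < 1 -> f z = (z * CPSeries (even_coef a) (z * z))%C.
Proof.
  intros HL Hexp Hz. destruct (Ceq_dec z (RtoC 0)) as [->|Hz0].
  - rewrite (L_zero _ HL). ring.
  - rewrite (CPSeries_unique _ _ _ (odd_expansion_series f a z Hexp Hz Hz0)). field. exact Hz0.
Qed.

Lemma odd_section_convex (f : C -> C) (a : nat -> C) (n : nat) :
  class_L f -> odd_expansion f a -> (1 <= n)%nat ->
  convex_in_disk (odd_section a n) (sqrt 2 / 3).
Proof.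
  intros HL Hexp Hn z Hz.
  set (al := even_coef a). pose proof (abs_conv_even_coef f a Hexp) as Hal.
  pose proof (fun z => class_L_CPSeries f a z HL Hexp) as Hf. fold al in Hf, Hal.
  pose proof (Cmod_ge_0 z) as Hz0.
  assert (Hw : Cmod (z * z) < 2 / 9).
  { rewrite Cmod_mult. pose proof (sqrt_sqrt 2). pose proof (sqrt_pos 2). nra. }
  assert (Hz1 : Cmod z < 1) by (rewrite Cmod_mult in Hw; nra).
  assert (Hroot : forall w, Cmod w < 1 -> exists y, Cmod y < 1 /\ (y * y)%C = w).
  { intros w Hw1. destruct (complex_sqrt w) as [y Hy]. exists y. split; [|exact Hy].
    rewrite <- Hy, Cmod_mult in Hw1. pose proof (Cmod_ge_0 y). nra. }
  destruct (section_log_der_unit_disk (odd_der_coef al) (z * z)%C n) as [H1 H2].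
  - now apply abs_conv_odd_der_coef.
  - unfold odd_der_coef, euler_coef, al. simpl. ring.
  - intros w Hw1. destruct (Hroot w Hw1) as [y [Hy <-]].
    rewrite <- (odd_C_derive f al Hal Hf y Hy). now apply (L_locally_univalent _ HL).
  - intros w Hw1. destruct (Hroot w Hw1) as [y [Hy <-]].
    pose proof (L_Re _ HL y Hy) as H.
    rewrite (odd_convexity_quotient f al Hal Hf y Hy), re_plus, re_RtoC in H. lra.
  - exact Hw.
  - exact Hn.
  (* The section is again [z] times a series in [z^2], and [odd_der_coef] commutes with truncation,
     so its derivative is the truncation of [g] at [z^2]. *)
  - pose proof (abs_conv_trunc 1 n al Hal) as Ht.
    assert (Hs : forall z, Cmod z < 1 -> odd_section a n z = (z * CPSeries (trunc n al) (z * z))%C)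
      by (intros y _; now apply odd_section_CPSeries).
    rewrite (odd_C_derive _ _ Ht Hs z Hz1), (odd_convexity_quotient _ _ Ht Hs z Hz1).
    rewrite (CPSeries_ext _ _ _ (odd_der_coef_trunc n al)), (log_der_ext _ _ _ (odd_der_coef_trunc n al)).
    split; [exact H1|]. rewrite re_plus, re_RtoC. lra.
Qed.

(** * Sharpness of the radius *)

(* The extremal function [z / sqrt (1 - z^2)]; [Nat.div2 (2 k + 1) = k]. *)
Definition ext_a (m : nat) : C := RtoC (ext_coef (Nat.div2 m) / INR m).

(** Given by its series, so that no branch of the square root has to be chosen. *)
Definition ext_f (z : C) : C := (z * CPSeries (even_coef ext_a) (z * z))%C.

Lemma even_coef_ext_a (k : nat) : even_coef ext_a k = RtoC (ext_coef k / (2 * INR k + 1)).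
Proof.
  destruct k as [|k]; [simpl; f_equal; field|].
  unfold even_coef, ext_a. rewrite plus_INR, mult_INR.
  replace (Nat.div2 (2 * S k + 1)) with (S k)
    by (rewrite Nat.add_1_r; symmetry; apply Nat.div2_succ_double).
  reflexivity.
Qed.

Lemma odd_der_coef_ext_a (k : nat) : odd_der_coef (even_coef ext_a) k = RtoC (ext_coef k).
Proof.
  unfold odd_der_coef, euler_coef. rewrite even_coef_ext_a, <- !RtoC_mult, <- RtoC_plus.
  f_equal. pose proof (pos_INR k). field. lra.
Qed.

(** Comparison with [k + 1], the coefficients of the derivative of the geometric series. *)
Lemma abs_conv_ext_coef : abs_conv 1 (fun k => RtoC (ext_coef k)).
Proof.
  apply abs_conv_le with (derive_coef (fun _ => RtoC 1)).
  - intros k. unfold derive_coef. rewrite <- RtoC_mult, !Cmod_R, !Rabs_pos_eq.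
    + rewrite Rmult_1_r. induction k as [|k IH]; [simpl; lra|].
      pose proof (ext_coef_S k) as E. pose proof (pos_INR k). rewrite !S_INR in *.
      apply Rmult_le_reg_l with (2 * INR k + 2); [lra|]. rewrite E. nra.
    + pose proof (pos_INR (S k)). lra.
    + left. apply ext_coef_pos.
  - apply abs_conv_derive_coef. intros r Hr.
    apply ex_series_ext with (fun n => r ^ n).
    + intros n. rewrite Cmod_1. simpl. ring.
    + apply ex_series_geom. rewrite Rabs_pos_eq; lra.
Qed.

Lemma abs_conv_even_coef_ext_a : abs_conv 1 (even_coef ext_a).
Proof.
  apply abs_conv_le with (2 := abs_conv_ext_coef). intros k. rewrite even_coef_ext_a, !Cmod_R.
  pose proof (ext_coef_pos k). pose proof (pos_INR k).
  rewrite !Rabs_pos_eq; [| lra | apply Rdiv_le_0_compat; lra].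
  apply Rmult_le_reg_r with (2 * INR k + 1); [lra|].
  replace (ext_coef k / (2 * INR k + 1) * (2 * INR k + 1)) with (ext_coef k) by (field; lra). nra.
Qed.

Local Notation ext_g := (CPSeries (fun k => RtoC (ext_coef k))).
Local Notation ext_dg := (CPSeries (derive_coef (fun k => RtoC (ext_coef k)))).

(** The recurrence [(k + 1) c_(k+1) = k c_k + (3/2) c_k], read as an identity of power series. *)
Lemma ext_g_ode (w : C) : Cmod w < 1 -> ((1 - w) * ext_dg w = RtoC (3 / 2) * ext_g w)%C.
Proof.
  intros Hw. pose proof abs_conv_ext_coef as Hc.
  assert (E : ext_dg w = (w * ext_dg w + RtoC (3 / 2) * ext_g w)%C).
  { rewrite <- (CPSeries_euler_coef 1), <- (CPSeries_scal 1), <- (CPSeries_plus 1)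
      by auto using abs_conv_euler_coef, abs_conv_scal.
    apply CPSeries_ext. intros k. unfold derive_coef, euler_coef.
    rewrite <- !RtoC_mult, <- RtoC_plus. f_equal.
    rewrite S_INR. pose proof (ext_coef_S k). lra. }
  replace ((1 - w) * ext_dg w)%C with (ext_dg w - w * ext_dg w)%C by ring.
  rewrite E at 1. ring.
Qed.

(** Squaring states [g = (1 - w)^(-3/2)] without complex powers. By the differential equation the
    left side is constant along the segment from [0] to [w]. It shows that [g] has no zero. *)
Lemma ext_g_first_integral (w : C) : Cmod w < 1 ->
  (ext_g w * ext_g w * ((1 - w) * (1 - w) * (1 - w)))%C = RtoC 1.
Proof.
  intros Hw. pose proof abs_conv_ext_coef as Hc.
  set (N := fun w => (ext_g w * ext_g w * ((1 - w) * (1 - w) * (1 - w)))%C).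
  assert (D : forall z, Cmod z < 1 -> Cder N z (RtoC 0)).
  { intros z Hz.
    assert (D1 : Cder (fun y => 1 - y)%C z (- RtoC 1)%C).
    { apply (is_derive_ext (K := C_AbsRing) (V := AbsRing_NormedModule C_AbsRing)
               (fun y => RtoC 1 + (- RtoC 1) * y)%C).
      - intros y. change (RtoC 1 + - RtoC 1 * y = 1 - y)%C. ring.
      - apply Cder_affine. }
    pose proof (CPSeries_derive 1 _ z Hc Hz) as Dg.
    pose proof (Cder_mult _ _ _ _ _ (Cder_mult _ _ _ _ _ Dg Dg)
      (Cder_mult _ _ _ _ _ (Cder_mult _ _ _ _ _ D1 D1) D1)) as DN.
    eapply Cder_val; [|exact DN].
    pose proof (ext_g_ode z Hz) as E.
    assert (E3 : (2 * ((1 - z) * ext_dg z) = 3 * ext_g z)%C).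
    { rewrite E. replace (RtoC (3 / 2)) with (RtoC 3 / RtoC 2)%C
        by (rewrite RtoC_div; [reflexivity|lra]). field. }
    transitivity (ext_g z * ((1 - z) * (1 - z)) * (2 * ((1 - z) * ext_dg z) - 3 * ext_g z))%C.
    - ring.
    - rewrite E3. ring. }
  assert (E : N (RtoC 0 * w)%C = N (RtoC 1 * w)%C).
  { apply (curve_der_0_eq (fun t => N (RtoC t * w)%C) 0 1); [lra|]. intros t Ht.
    replace (RtoC 0) with ((RtoC 1 * w) * RtoC 0)%C by ring.
    apply (curve_der_comp N (fun t => RtoC t * w)%C).
    - apply D. rewrite Cmod_mult, Cmod_R, Rabs_pos_eq by lra.
      pose proof (Cmod_ge_0 w). nra.
    - apply (curve_der_ext (fun t => (fun y => RtoC 0 + w * y)%C (RtoC t)) _ t (RtoC 1 * w)%C).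
      + intros s. ring.
      + reflexivity.
      + apply (curve_der_comp (fun y => RtoC 0 + w * y)%C RtoC);
          [apply Cder_affine | apply curve_der_RtoC]. }
  rewrite Cmult_0_l, Cmult_1_l in E. fold (N w). rewrite <- E. unfold N.
  rewrite (CPSeries_0 1) by (auto; lra). simpl. ring.
Qed.

Lemma ext_g_neq_0 (w : C) : Cmod w < 1 -> ext_g w <> RtoC 0.
Proof.
  intros Hw E. pose proof (ext_g_first_integral w Hw) as H. rewrite E, !Cmult_0_l in H.
  symmetry in H. now apply C1_nz in H.
Qed.

(** The differential equation gives [Q = 3 / (1 - w) - 3], and [Re (1 / (1 - w)) > 1/2] in the
    disk. *)
Lemma log_der_ext_g (w : C) : Cmod w < 1 -> - (3 / 2) < Re (log_der (fun k => RtoC (ext_coef k)) w).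
Proof.
  intros Hw. pose proof abs_conv_ext_coef as Hc.
  assert (H1 : (1 - w)%C <> RtoC 0).
  { intros E. assert (Ew : w = RtoC 1) by (replace w with (1 - (1 - w))%C by ring; rewrite E; ring).
    rewrite Ew, Cmod_1 in Hw. lra. }
  assert (E : log_der (fun k => RtoC (ext_coef k)) w = (3 * / (1 - w) - 3)%C).
  { unfold log_der. rewrite (CPSeries_euler_coef 1) by assumption. pose proof (ext_g_neq_0 w Hw) as Hg.
    replace (ext_dg w) with (RtoC 3 / RtoC 2 * ext_g w / (1 - w))%C.
    - field. split; assumption.
    - rewrite <- RtoC_div, <- (ext_g_ode w Hw) by lra. field. exact H1. }
  rewrite E. unfold Cminus at 1. rewrite re_plus, re_scal_l, re_opp, re_RtoC.
  pose proof (Re_inv_one_minus w (Cmod w) (Rle_refl _) Hw) as H.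
  assert (/ 2 < / (1 + Cmod w)).
  { apply Rinv_lt_contravar; [|lra]. pose proof (Cmod_ge_0 w). lra. }
  lra.
Qed.

Lemma odd_expansion_ext_f : odd_expansion ext_f ext_a.
Proof.
  intros z Hz. pose proof (Cmod_square_lt_1 z Hz) as Hw. pose proof abs_conv_even_coef_ext_a as Hc.
  pose proof (is_series_scal (K := C_AbsRing) (V := C_NormedModule) (z * (z * z))%C _ _
    (CPSeries_is_series 1 _ (z * z)%C (abs_conv_shift 1 _ Hc) Hw)) as H.
  replace (ext_f z - z)%C with (scal (z * (z * z))%C (CPSeries (fun n => even_coef ext_a (S n)) (z * z)) : C).
  - eapply is_series_ext; [|exact H]. intros j. cbv beta zeta.
    replace (2 * (j + 2) - 1)%nat with (2 * S j + 1)%nat by lia.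
    rewrite odd_pow, Cpow_S. cbn [even_coef].
    change (z * (z * z) * (ext_a (2 * S j + 1) * (z * z) ^ j) =
            ext_a (2 * S j + 1) * (z * (z * z * (z * z) ^ j)))%C. ring.
  - unfold ext_f. rewrite (CPSeries_shift 1 _ _ Hc Hw).
    change (z * (z * z) * CPSeries (fun n => even_coef ext_a (S n)) (z * z) =
      z * (RtoC 1 + z * z * CPSeries (fun n => even_coef ext_a (S n)) (z * z)) - z)%C. ring.
Qed.

Lemma class_L_ext_f : class_L ext_f.
Proof.
  pose proof abs_conv_even_coef_ext_a as Hc.
  assert (Hf : forall z, Cmod z < 1 -> ext_f z = (z * CPSeries (even_coef ext_a) (z * z))%C) by reflexivity.
  assert (E : forall z, Cmod z < 1 -> C_derive ext_f z = ext_g (z * z)).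
  { intros z Hz. rewrite (odd_C_derive ext_f _ Hc Hf z Hz). apply CPSeries_ext, odd_der_coef_ext_a. }
  assert (H0 : Cmod (RtoC 0) < 1) by (rewrite Cmod_0; lra).
  constructor.
  - intros z Hz. eexists. apply Cder_is_derive, (odd_Cder ext_f _ Hc Hf z Hz).
  - intros z Hz. unfold ext_f. replace (- z * - z)%C with (z * z)%C by ring. ring.
  - unfold ext_f. ring.
  - rewrite E by exact H0. replace (RtoC 0 * RtoC 0)%C with (RtoC 0) by ring.
    rewrite (CPSeries_0 1); [reflexivity | lra | apply abs_conv_ext_coef].
  - intros z Hz. rewrite E by exact Hz. now apply ext_g_neq_0, Cmod_square_lt_1.
  - intros z Hz. rewrite (odd_convexity_quotient ext_f _ Hc Hf z Hz).
    rewrite (log_der_ext _ _ _ odd_der_coef_ext_a), re_plus, re_RtoC.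
    pose proof (log_der_ext_g _ (Cmod_square_lt_1 z Hz)). lra.
Qed.

Lemma ext_f_section_not_convex (r : R) : sqrt 2 / 3 < r -> ~ convex_in_disk (odd_section ext_a 2) r.
Proof.
  intros Hr Hcv. pose proof abs_conv_even_coef_ext_a as Hc.
  assert (S2 : sqrt 2 * sqrt 2 = 2) by (apply sqrt_sqrt; lra). pose proof (sqrt_pos 2) as S0.
  assert (Hs2 : sqrt 2 < 2) by nra.
  (* Here [w = z^2 = -2/9], the truncated [g] is [1 + (3/2) w = 2/3], and the quotient is
     [1 + (-2/3) / (2/3) = 0]. *)
  set (z := (Ci * RtoC (sqrt 2 / 3))%C).
  assert (Ez : (z * z)%C = RtoC (- (2 / 9))).
  { unfold z, Ci, Cmult, RtoC; simpl. f_equal; nra. }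
  assert (Hm : Cmod z = sqrt 2 / 3).
  { unfold z. rewrite Cmod_mult, Cmod_Ci, Cmod_R, Rabs_pos_eq; lra. }
  assert (Hz1 : Cmod z < 1) by lra.
  destruct (Hcv z) as [_ H]; [rewrite Hm; exact Hr|].
  assert (Hs : forall z, Cmod z < 1 ->
    odd_section ext_a 2 z = (z * CPSeries (trunc 2 (even_coef ext_a)) (z * z))%C)
    by (intros y _; apply odd_section_CPSeries; lia).
  rewrite (odd_convexity_quotient _ _ (abs_conv_trunc 1 2 _ Hc) Hs z Hz1) in H.
  rewrite (log_der_ext _ _ _ (odd_der_coef_trunc 2 _)), Ez in H.
  set (b := trunc 2 (odd_der_coef (even_coef ext_a))) in *.
  assert (Hb : abs_conv 1 b) by (apply abs_conv_trunc_any).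
  assert (B0 : b 0%nat = RtoC 1).
  { unfold b, trunc. cbn [Nat.ltb Nat.leb]. now rewrite odd_der_coef_ext_a. }
  assert (B1 : b 1%nat = RtoC (3 / 2)).
  { unfold b, trunc. cbn [Nat.ltb Nat.leb]. rewrite odd_der_coef_ext_a. simpl. f_equal. field. }
  assert (B2 : forall k, b (S (S k)) = RtoC 0) by reflexivity.
  assert (Hw : Cmod (RtoC (- (2 / 9))) < 1) by (rewrite Cmod_R, Rabs_left; lra).
  unfold log_der in H. rewrite (CPSeries_linear 1 b _ Hb Hw B2) in H.
  rewrite (CPSeries_linear 1 (euler_coef b) _ (abs_conv_euler_coef _ _ Hb) Hw) in H
    by (intros k; unfold euler_coef; rewrite B2; ring).
  unfold euler_coef in H. rewrite B0, B1 in H. simpl INR in H.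
  rewrite <- !RtoC_mult, <- !RtoC_plus, <- RtoC_mult, <- RtoC_div, <- RtoC_plus in H by lra.
  rewrite re_RtoC in H.
  match type of H with 0 < ?x => replace x with 0 in H by field end. lra.
Qed.

Theorem mainTheorem1 :
  (forall (f : C -> C) (a : nat -> C),
      class_L f -> odd_expansion f a ->
      forall n : nat, (1 <= n)%nat ->
        convex_in_disk (odd_section a n) (sqrt 2 / 3)) /\
  (forall r : R, sqrt 2 / 3 < r ->
      exists (f : C -> C) (a : nat -> C) (n : nat),
        class_L f /\ odd_expansion f a /\ (1 <= n)%nat /\
        ~ convex_in_disk (odd_section a n) r).
Proof.
  split.
  - intros f a HL Hexp n Hn. now apply (odd_section_convex f).
  - intros r Hr. exists ext_f, ext_a, 2%nat.
    split; [exact class_L_ext_f|]. split; [exact odd_expansion_ext_f|].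
    split; [lia | now apply ext_f_section_not_convex].
Qed.
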